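(* Let $G^{\alpha}=\langle X\mid R\rangle$ be a presentation of a group $G$ with $n$ generators. Then $1-n\le \hat\Xi(G^{\alpha})\le 1$. Moreover: (i) if $G$ is amenable then $\hat\Xi(G^{\alpha})=1/|G|$, where $1/|G|$ is defined to be $0$ if $|G|=\infty$; (ii) if $G$ is non-amenable then $1-n\le\hat\Xi(G^{\alpha})<0$, with $\hat\Xi(G^{\alpha})=1-n$ if and only if $G$ is free of rank $n\ge 2$.
   Context: Let $G^{\alpha}=\langle X\mid R\rangle$, $X=\{x_1,\dots,x_n\}$ finite, be a presentation of a group $G$. The generators are regarded as distinct symbols, although different symbols may represent the same element of $G$ and a symbol may represent the identity. The associated Cayley graph $\Gamma$ has vertex set $G$ and, for every $g\in G$ and every $j\in\{1,\dots,n\}$, exactly one edge with initial vertex $g$ and terminal vertex $gx_j$, labelled $x_j$ (and $x_j^{-1}$ in the reverse direction); so edges correspond bijectively to $G\times X$, and loops and multiple edges are allowed. For a non-empty finite subgraph $\Gamma'$ of $\Gamma$ let $\beta_0(\Gamma')$ be its number of vertices, let $\beta_2(\Gamma')$ be its cyclomatic number, i.e. the sum over its connected components of the rank of the fundamental group of the component, and let $\xi(\Gamma')=\beta_2(\Gamma')/\beta_0(\Gamma')$. An exhausting chain is a sequence $\Gamma_1\subseteq\Gamma_2\subseteq\cdots$ of finite connected subgraphs of $\Gamma$ whose union is $\Gamma$. The cyclomatic quotient of $G^{\alpha}$ is $$\Xi(G^{\alpha})=\sup \limsup_{i\to\infty}\xi(\Gamma_i),$$ the supremum being over all exhausting chains;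 equivalently, $\Xi(G^{\alpha})=\sup\xi(\Gamma')$ over all non-empty finite subgraphs $\Gamma'$ of $\Gamma$. The normalized cyclomatic quotient is $\hat\Xi(G^{\alpha})=1-n+\Xi(G^{\alpha})$. *)

(* Defs.v *)
From HB Require Import structures.
From mathcomp Require Import all_boot all_order all_algebra finmap.
From mathcomp Require Import all_classical all_reals all_analysis.

Set Implicit Arguments.
Unset Strict Implicit.
Unset Printing Implicit Defensive.

Import Order.TTheory GRing.Theory Num.Theory.

Local Open Scope classical_set_scope.
Local Open Scope ring_scope.

(* The letter (a, true) stands for a, and (a, false) for its inverse. *)
Definition word (A : Type) := seq (A * bool).

Definition inv_word (A : Type) (w : word A) : word A :=
  rev [seq (l.1, ~~ l.2) | l <- w].

(* [word_eq rels u v]: the words u and v represent the same element of the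
   group < A | rels >, i.e. they are equal in the free group on A modulo the
   normal closure of rels. *)
Inductive word_eq (A : Type) (rels : set (word A)) : word A -> word A -> Prop :=
| word_eq_refl u : word_eq rels u u
| word_eq_sym u v : word_eq rels u v -> word_eq rels v u
| word_eq_trans u v w :
    word_eq rels u v -> word_eq rels v w -> word_eq rels u w
| word_eq_cancel u v a b :
    word_eq rels (u ++ [:: (a, b); (a, ~~ b)] ++ v) (u ++ v)
| word_eq_rel u v r : rels r -> word_eq rels (u ++ r ++ v) (u ++ v).

Definition free_eq (A : Type) : word A -> word A -> Prop := word_eq set0.

Definition eval_word (G : groupType) (A : Type) (x : A -> G) (w : word A) : G :=
  (\prod_(l <- w) (if l.2 then x l.1 else (x l.1)^-1))%g.

(* The family x need not be injective and may take the value 1. *)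
Definition presents (G : groupType) (A : Type) (x : A -> G)
    (rels : set (word A)) : Prop :=
  (forall g, exists w, eval_word x w = g) /\
  (forall w, eval_word x w = 1%g <-> word_eq rels w [::]).

Definition free_of_rank (G : groupType) (r : nat) : Prop :=
  exists y : 'I_r -> G, presents y set0.

Record multigraph := Multigraph {
  vertex : choiceType;
  edge : choiceType;
  source : edge -> vertex;
  target : edge -> vertex }.

Record finsubgraph (Gm : multigraph) := FinSubgraph {
  verts : {fset vertex Gm};
  edges : {fset edge Gm};
  edges_closed :
    all (fun e => (source e \in verts) && (target e \in verts)) edges }.

Section Subgraph.
Variable Gm : multigraph.
Implicit Types (S T : finsubgraph Gm) (u v : vertex Gm) (p : word (edge Gm)).

Definition subgraph_le S T : Prop :=
  (verts S `<=` verts T)%fset /\ (edges S `<=` edges T)%fset.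

(* [is_path S u p v]: p is an edge path in S from u to v; the letter (e, false)
   traverses e from its target to its source. *)
Fixpoint is_path S u p v : bool :=
  if p is (e, b) :: p' then
    [&& e \in edges S, (if b then source e else target e) == u
      & is_path S (if b then target e else source e) p' v]
  else (u == v) && (u \in verts S).

Definition joined S u v : Prop := exists p, is_path S u p v.

Definition connected_subgraph S : Prop :=
  verts S != fset0%fset /\ {in verts S &, forall u v, joined S u v}.

Definition component S v : {fset vertex Gm} :=
  [fset u in verts S | `[< joined S v u >]]%fset.

Definition components S : {fset {fset vertex Gm}} :=
  [fset component S v | v in verts S]%fset.

(* Substitution of the paths p i for the letters i. *)
Definition subst_word r (p : 'I_r -> word (edge Gm)) (w : word 'I_r) :
    word (edge Gm) :=
  flatten [seq if l.2 then p l.1 else inv_word (p l.1) | l <- w].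

(* The elements of the fundamental group of S at v are the closed paths of S at
   v up to homotopy, i.e. up to insertion and deletion of backtracks; the
   product is concatenation.  [pi1_basis S v p] says that it is free on the
   classes of the p i.  A path starting at v stays in the component of v, so
   this is also the fundamental group of that component. *)
Definition pi1_basis S v r (p : 'I_r -> word (edge Gm)) : Prop :=
  [/\ forall i, is_path S v (p i) v,
      forall q, is_path S v q v -> exists w, free_eq q (subst_word p w)
    & forall w, free_eq (subst_word p w) [::] -> free_eq w [::]].

(* The rank of the fundamental group of the component C: the cardinality of a
   basis, which depends neither on the basis nor on the base point.  The
   default value 0 is never used when C is a component of S. *)
Definition pi1_rank S (C : {fset vertex Gm}) : nat :=
  xget 0%N [set r | exists2 v, v \in C &
                    exists p : 'I_r -> word (edge Gm), pi1_basis S v p].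

Definition beta0 S : nat := #|` verts S|.

Definition beta2 S : nat := (\sum_(C <- components S) pi1_rank S C)%N.

Definition xi (R : realType) S : R := (beta2 S)%:R / (beta0 S)%:R.

Definition exhausting_chain (S : nat -> finsubgraph Gm) : Prop :=
  [/\ forall i, connected_subgraph (S i),
      forall i, subgraph_le (S i) (S i.+1),
      forall v, exists i, v \in verts (S i)
    & forall e, exists i, e \in edges (S i)].

End Subgraph.

Definition cayley_graph (G : groupType) (n : nat) (x : 'I_n -> G) : multigraph :=
  @Multigraph G (G * 'I_n)%type (fun e => e.1) (fun e => (e.1 * x e.2)%g).

Definition cyclomatic_quotient (R : realType) (G : groupType) (n : nat)
    (x : 'I_n -> G) : \bar R :=
  ereal_sup [set limn_esup (fun i => (xi R (S i))%:E)
            | S in @exhausting_chain (cayley_graph x)].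

Definition normalized_cyclomatic_quotient (R : realType) (G : groupType)
    (n : nat) (x : 'I_n -> G) : \bar R :=
  ((1 - n%:R)%:E + cyclomatic_quotient R x)%E.

(* G carries a left-invariant finitely additive probability measure defined on
   all of its subsets. *)
Definition amenable (R : realType) (G : groupType) : Prop :=
  exists mu : set G -> R,
    [/\ forall A, 0 <= mu A,
        mu setT = 1,
        forall A B, A `&` B = set0 -> mu (A `|` B) = mu A + mu B
      & forall g A, mu [set (g * a)%g | a in A] = mu A].

Definition inv_card (R : realType) (T : choiceType) : R :=
  if `[< finite_set [set: T] >] then (#|` fset_set [set: T]|)%:R^-1 else 0.

(* Main.v *)
Require Import Defs.
From mathcomp Require Import all_boot all_order all_algebra all_fingroup finmap.
From mathcomp Require Import all_classical all_reals all_analysis.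
From mathcomp Require Import zify ring lra.

(** For a connected finite subgraph with vertex set [V] and edge set [E], the
    cyclomatic number is [|E| - |V| + 1]: a spanning tree yields a free basis of
    the fundamental group indexed by the edges outside the tree, and two bases
    have the same cardinality because exponent sums compare the abelianizations
    ([beta2_connected], [pi1_rank_unique]).  Hence
    [xi = (|E| + 1) / |V| - 1].  Every vertex has [n] outgoing edges, so
    [|E| <= n |V|], and [1 / |V|] tends to [1 / |G|] along an exhausting chain;
    this gives [0 <= Xi <= n - 1 + 1 / |G|], hence the general bounds
    ([cyclomatic_quotient_ge0], [cyclomatic_quotient_le]).

    Whether [Xi] reaches [n - 1 + 1 / |G|] depends on the existence of finite
    sets [F] of vertices almost all of whose [n |F|] outgoing edges end in [F]
    ([folner]).  If such sets exist, then those of minimal cardinality are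
    connected, and in an infinite group they are arbitrarily large; so they can
    absorb any given finite connected subgraph, and they yield an exhausting
    chain with the maximal quotient ([folner_cyclomatic_quotient]).  If they do
    not exist, then [|E| < (n - e) |V|] for some [e > 0] and all finite
    subgraphs, so that [Xi < n - 1] ([not_folner_lt]).

    The existence of such sets is equivalent to amenability.  A limit along an
    ultrafilter of the counting measures on them is an invariant mean
    ([folner_amenable]).  If there are none, then multiplication by a large
    ball at least doubles the size of every finite set, and the marriage theorem
    gives a piecewise translation that is injective on two copies of [G], which
    contradicts the existence of an invariant mean ([amenable_folner]).

    It remains to see when [Xi = 0].  If the family [x] is free, then the Cayley
    graph is a tree and all cyclomatic numbers vanish.  Otherwise a shortest
    nontrivial relator shows that some edge at the identity can be bypassed.  In
    a ball, the translates of this edge by a positive proportion of the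
    elements can be deleted simultaneously without disconnecting the ball,
    whence [Xi > 0] ([nonfree_cyclomatic_quotient]).  Finally, [n] generators of
    a free group of rank [n] are free, since such a group is Hopfian
    ([free_of_rank_free_family]).  The condition [2 <= n] is automatic for a
    non-amenable group, because [1 - n <= 1 - n + Xi < 0]. *)

Set Implicit Arguments.
Unset Strict Implicit.
Unset Printing Implicit Defensive.

Import Order.TTheory GRing.Theory Num.Theory.
Import numFieldNormedType.Exports.

Local Open Scope ring_scope.

(** * Words and the congruence they carry *)

Section WordEq.
Variables (A : Type) (rels : set (word A)).
Implicit Types u v w : word A.
Local Notation "u ~~> v" := (word_eq rels u v) (at level 70).

Lemma word_eq_ctx s t u v : u ~~> v -> s ++ u ++ t ~~> s ++ v ++ t.
Proof.
move=> h; elim: h s t => {u v}.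
- by move=> u s t; exact: word_eq_refl.
- by move=> u v _ IH s t; exact/word_eq_sym/IH.
- by move=> u v w _ IH1 _ IH2 s t; exact: word_eq_trans (IH1 s t) (IH2 s t).
- move=> u v a b s t.
  have := @word_eq_cancel A rels (s ++ u) (v ++ t) a b.
  by rewrite -!catA.
- move=> u v r hr s t.
  have := @word_eq_rel A rels (s ++ u) (v ++ t) r hr.
  by rewrite -!catA.
Qed.

Lemma word_eq_cat u u' v v' : u ~~> u' -> v ~~> v' -> u ++ v ~~> u' ++ v'.
Proof.
move=> hu hv; apply: (@word_eq_trans _ _ _ (u' ++ v)).
  exact: (word_eq_ctx [::] v hu).
by have := word_eq_ctx u' [::] hv; rewrite !cats0.
Qed.

Lemma word_eq_catl s u v : u ~~> v -> s ++ u ~~> s ++ v.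
Proof. by move=> h; apply: word_eq_cat => //; exact: word_eq_refl. Qed.

Lemma word_eq_catr t u v : u ~~> v -> u ++ t ~~> v ++ t.
Proof. by move=> h; apply: word_eq_cat => //; exact: word_eq_refl. Qed.

Lemma inv_word_cat u v : inv_word (u ++ v) = inv_word v ++ inv_word u.
Proof. by rewrite /inv_word map_cat rev_cat. Qed.

Lemma inv_word_cons l u : inv_word (l :: u) = inv_word u ++ [:: (l.1, ~~ l.2)].
Proof. by rewrite -cat1s inv_word_cat. Qed.

Lemma inv_wordK : involutive (@inv_word A).
Proof.
by move=> u; elim: u => [|[a b] u IH] //; rewrite inv_word_cons inv_word_cat IH /= negbK.
Qed.

Lemma word_eqV u : u ++ inv_word u ~~> [::].
Proof.
elim: u => [|[a b] u IH]; first exact: word_eq_refl.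
rewrite inv_word_cons -cat1s -catA [u ++ _]catA.
apply: word_eq_trans (word_eq_ctx [:: (a, b)] [:: (a, ~~ b)] IH) _.
exact: (@word_eq_cancel A rels [::] [::] a b).
Qed.

Lemma word_eqVl u : inv_word u ++ u ~~> [::].
Proof. by rewrite -{2}(inv_wordK u); exact: word_eqV. Qed.

Lemma word_eq_inv u v : u ~~> v -> inv_word u ~~> inv_word v.
Proof.
move=> h; apply: (@word_eq_trans _ _ _ (inv_word u ++ (v ++ inv_word v))).
  rewrite -{1}[inv_word u]cats0.
  exact/word_eq_catl/word_eq_sym/word_eqV.
rewrite catA -{2}[inv_word v]cat0s; apply: word_eq_catr.
apply: word_eq_trans (word_eq_catl _ (word_eq_sym h)) _.
exact: word_eqVl.
Qed.

Lemma word_eq_mulV u v : u ++ inv_word v ~~> [::] <-> u ~~> v.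
Proof.
split=> [h|h].
  rewrite -[u]cats0.
  apply: word_eq_trans (word_eq_catl u (word_eq_sym (word_eqVl v))) _.
  by rewrite catA -{3}[v]cat0s; exact: word_eq_catr.
exact: word_eq_trans (word_eq_catr _ h) (word_eqV v).
Qed.

End WordEq.

Section EvalWord.
Variables (G : groupType) (A : Type) (x : A -> G).
Implicit Types u v : word A.

Lemma eval_nil : eval_word x [::] = 1%g.
Proof. by rewrite /eval_word big_nil. Qed.

Lemma eval_cons l u :
  eval_word x (l :: u) = ((if l.2 then x l.1 else (x l.1)^-1) * eval_word x u)%g.
Proof. by rewrite /eval_word big_cons. Qed.

Lemma eval_cat u v : eval_word x (u ++ v) = (eval_word x u * eval_word x v)%g.
Proof. by rewrite /eval_word big_cat. Qed.

Lemma eval_inv u : eval_word x (inv_word u) = (eval_word x u)^-1%g.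
Proof.
elim: u => [|[a b] u IH]; first by rewrite /inv_word /= eval_nil invg1.
rewrite inv_word_cons eval_cat IH !eval_cons eval_nil mulg1 invgM.
by case: b => //=; rewrite invgK.
Qed.

Lemma eval_free_eq u v : free_eq u v -> eval_word x u = eval_word x v.
Proof.
elim=> {u v} // [u v w _ -> _ //|u v a b].
rewrite !eval_cat !eval_cons eval_nil mulg1 /=.
by case: b; rewrite /= ?mulgV ?mulVg mul1g.
Qed.

End EvalWord.

(** The homomorphism of free monoids with involution sending each letter [a]
    to the word [f a]. *)
Definition wsub (A B : Type) (f : A -> word B) (w : word A) : word B :=
  flatten [seq if l.2 then f l.1 else inv_word (f l.1) | l <- w].

Lemma subst_wordE (Gm : multigraph) r (p : 'I_r -> word (edge Gm)) w :
  subst_word p w = wsub p w.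
Proof. by []. Qed.

Section Wsub.
Variables A B : Type.
Implicit Types f g : A -> word B.

Lemma wsub_cons f l u :
  wsub f (l :: u) = (if l.2 then f l.1 else inv_word (f l.1)) ++ wsub f u.
Proof. by []. Qed.

Lemma wsub_cat f u v : wsub f (u ++ v) = wsub f u ++ wsub f v.
Proof. by rewrite /wsub map_cat flatten_cat. Qed.

Lemma wsub_inv f u : wsub f (inv_word u) = inv_word (wsub f u).
Proof.
elim: u => [|[a b] u IH] //.
rewrite inv_word_cons wsub_cat IH wsub_cons inv_word_cat /=.
by congr (_ ++ _); rewrite /wsub /= cats0; case: b => //=; rewrite inv_wordK.
Qed.

Lemma wsub_free_eq f u v : free_eq u v -> free_eq (wsub f u) (wsub f v).
Proof.
elim=> {u v} [u|u v _ IH|u v w _ IH1 _ IH2|u v a b|u v r []].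
- exact: word_eq_refl.
- exact: word_eq_sym.
- exact: word_eq_trans IH1 IH2.
rewrite !wsub_cat; apply: word_eq_catl.
rewrite -{2}[wsub f v]cat0s; apply: word_eq_catr.
rewrite /wsub /= cats0; case: b => /=; [exact: word_eqV | exact: word_eqVl].
Qed.

Lemma wsub_ext f g w : (forall a, free_eq (f a) (g a)) ->
  free_eq (wsub f w) (wsub g w).
Proof.
move=> h; elim: w => [|[a b] w IH]; first exact: word_eq_refl.
rewrite !wsub_cons; apply: word_eq_cat => //=.
by case: b; [exact: h|exact: (@word_eq_inv _ set0 _ _ (h a))].
Qed.

End Wsub.

Lemma wsub_comp (A B C : Type) (f : A -> word B) (g : B -> word C) w :
  wsub g (wsub f w) = wsub (fun a => wsub g (f a)) w.
Proof.
elim: w => [|[a b] w IH] //; rewrite !wsub_cons wsub_cat IH.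
by case: b => //=; rewrite wsub_inv.
Qed.

Lemma wsub_id (A : Type) (w : word A) : wsub (fun a => [:: (a, true)]) w = w.
Proof. by elim: w => [|[a []] w IH] //; rewrite wsub_cons IH. Qed.

(** * Rank of a free group *)

(** Exponent sum of the letter [i] in [w]. *)
Definition exponent_sum r (w : word 'I_r) (i : 'I_r) : rat :=
  \sum_(l <- w | l.1 == i) (if l.2 then 1 else -1).

Lemma exponent_sum_cat r (u v : word 'I_r) i :
  exponent_sum (u ++ v) i = exponent_sum u i + exponent_sum v i.
Proof. by rewrite /exponent_sum big_cat. Qed.

Lemma exponent_sum_cons r (l : 'I_r * bool) (u : word 'I_r) i :
  exponent_sum (l :: u) i =
  (if l.1 == i then if l.2 then 1 else -1 else 0) + exponent_sum u i.
Proof. by rewrite /exponent_sum big_cons; case: ifP; rewrite ?add0r. Qed.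

Lemma exponent_sum_inv r (u : word 'I_r) i :
  exponent_sum (inv_word u) i = - exponent_sum u i.
Proof.
elim: u => [|[a b] u IH]; first by rewrite /inv_word /exponent_sum !big_nil oppr0.
rewrite inv_word_cons exponent_sum_cat !exponent_sum_cons IH /=.
rewrite {2}/exponent_sum big_nil.
by case: eqP => _; case: b => /=; lra.
Qed.

Lemma exponent_sum_free_eq r (u v : word 'I_r) i :
  free_eq u v -> exponent_sum u i = exponent_sum v i.
Proof.
elim=> {u v} // [u v w _ -> _ //|u v a b].
rewrite !exponent_sum_cat !exponent_sum_cons {2}/exponent_sum big_nil /=.
by case: eqP => _; case: b => /=; lra.
Qed.

Lemma exponent_sum_wsub r s (f : 'I_r -> word 'I_s) (w : word 'I_r) j :
  exponent_sum (wsub f w) j =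
  \sum_i exponent_sum w i * exponent_sum (f i) j.
Proof.
elim: w => [|[a b] w IH].
  rewrite [LHS]/exponent_sum big_nil big1 // => i _.
  by rewrite /exponent_sum big_nil mul0r.
rewrite wsub_cons exponent_sum_cat IH /=.
under [RHS]eq_bigr => i _ do rewrite exponent_sum_cons mulrDl.
rewrite big_split /=; congr (_ + _).
rewrite (bigD1 a) //= eqxx big1 ?addr0 => [|i]; last first.
  by rewrite eq_sym => /negPf ->; rewrite mul0r.
by case: b; rewrite ?mul1r // exponent_sum_inv mulN1r.
Qed.

(** A retract of a free group of rank [s] that is free of rank [r] satisfies
    [r <= s], by comparison of the abelianizations. *)
Lemma free_retract_rank r s (f : 'I_r -> word 'I_s) (g : 'I_s -> word 'I_r) :
  (forall i, free_eq (wsub g (f i)) [:: (i, true)]) -> (r <= s)%N.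
Proof.
move=> h.
pose F : 'M[rat]_(r, s) := \matrix_(i, j) exponent_sum (f i) j.
pose H : 'M[rat]_(s, r) := \matrix_(i, j) exponent_sum (g i) j.
apply: (@mulmx1_min _ _ _ F H); apply/matrixP => i j.
rewrite mxE; under eq_bigr do rewrite !mxE.
rewrite -exponent_sum_wsub (exponent_sum_free_eq j (h i)) exponent_sum_cons.
by rewrite {1}/exponent_sum big_nil addr0 mxE /=; case: eqP.
Qed.

(** * Euler characteristic of a finite connected graph *)

Section Paths.
Variable Gm : multigraph.
Implicit Types (S : finsubgraph Gm) (u v w : vertex Gm).
Implicit Types (T : {fset edge Gm}) (p q : word (edge Gm)) (e : edge Gm).

(** The vertices between which a letter of an edge path travels. *)
Definition letter_start (l : edge Gm * bool) : vertex Gm :=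
  if l.2 then source l.1 else target l.1.

Definition letter_end (l : edge Gm * bool) : vertex Gm :=
  if l.2 then target l.1 else source l.1.

Lemma is_path_cons S u l p v :
  is_path S u (l :: p) v =
  [&& l.1 \in edges S, letter_start l == u & is_path S (letter_end l) p v].
Proof. by case: l. Qed.

Lemma edge_endsP S e : e \in edges S ->
  source e \in verts S /\ target e \in verts S.
Proof. by move=> he; have /allP/(_ _ he)/andP := edges_closed S. Qed.

Lemma letter_startP S l : l.1 \in edges S -> letter_start l \in verts S.
Proof. by case: l => e [] /edge_endsP [h1 h2]. Qed.

Lemma letter_endP S l : l.1 \in edges S -> letter_end l \in verts S.
Proof. by case: l => e [] /edge_endsP [h1 h2]. Qed.

Lemma is_path_nil S u v : is_path S u [::] v = (u == v) && (u \in verts S).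
Proof. by []. Qed.

Lemma is_path_cat S u p v q w :
  is_path S u p v -> is_path S v q w -> is_path S u (p ++ q) w.
Proof.
elim: p u => [u /andP[/eqP -> //]|l p IH u].
by rewrite cat_cons !is_path_cons => /and3P[-> -> /IH] /[apply].
Qed.

Lemma is_path_inv S u p v : is_path S u p v -> is_path S v (inv_word p) u.
Proof.
elim: p u => [u /andP[/eqP -> h]|l p IH u]; first by rewrite is_path_nil eqxx.
rewrite is_path_cons inv_word_cons => /and3P[he /eqP hu /IH h].
apply: is_path_cat h _.
have hs := letter_startP he.
move: he hs hu; case: l => e b; rewrite is_path_cons is_path_nil.
rewrite /letter_start /letter_end /=.
by case: b => he hs <-; rewrite /= he eqxx hs eqxx.
Qed.

Lemma is_path_edge S l : l.1 \in edges S ->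
  is_path S (letter_start l) [:: l] (letter_end l).
Proof.
by move=> he; rewrite is_path_cons is_path_nil he !eqxx letter_endP.
Qed.

Lemma is_path_sub S (S' : finsubgraph Gm) u p v :
  subgraph_le S S' -> is_path S u p v -> is_path S' u p v.
Proof.
case=> hV hE; elim: p u => [u /andP[/eqP -> h]|l p IH u].
  by rewrite is_path_nil eqxx (fsubsetP hV).
by rewrite !is_path_cons => /and3P[/(fsubsetP hE) -> -> /IH].
Qed.

Lemma joined_refl S v : v \in verts S -> joined S v v.
Proof. by move=> hv; exists [::]; rewrite is_path_nil eqxx. Qed.

Lemma joined_sym S u v : joined S u v -> joined S v u.
Proof. by case=> p /is_path_inv; exists (inv_word p). Qed.

Lemma joined_trans S u v w : joined S u v -> joined S v w -> joined S u w.
Proof. by case=> p hp [q hq]; exists (p ++ q); exact: is_path_cat hp hq. Qed.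

Lemma joined_sub S (S' : finsubgraph Gm) u v : subgraph_le S S' -> joined S u v -> joined S' u v.
Proof. by move=> hST [p hp]; exists p; exact: is_path_sub hp. Qed.

Lemma connected_of_root S r : r \in verts S ->
  (forall u, u \in verts S -> joined S u r) -> connected_subgraph S.
Proof.
move=> hr h; split; first by apply/fset0Pn; exists r.
move=> u v hu hv; exact: joined_trans (h u hu) (joined_sym (h v hv)).
Qed.

Lemma crossing_edge S (W : {fset vertex Gm}) u p v :
  is_path S u p v -> u \in W -> v \notin W ->
  exists l, [/\ l.1 \in edges S, letter_start l \in W & letter_end l \notin W].
Proof.
elim: p u => [u /andP[/eqP -> _] -> //|l p IH u].
rewrite is_path_cons => /and3P[he /eqP hu hp] huW hv.
have [hl|hl] := boolP (letter_end l \in W); first exact: IH hp hl hv.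
by exists l; rewrite hu.
Qed.

(** [rooted_tree S v W T tau]: the edges [T] form a tree with vertices [W]
    inside [S], and [tau u] is a path in it from the root [v] to [u].  That [T]
    contains no cycle is expressed by the last clause: up to backtracks, the
    paths [tau] are compatible with the edges of [T]. *)
Record rooted_tree S v (W : {fset vertex Gm}) (T : {fset edge Gm})
    (tau : vertex Gm -> word (edge Gm)) : Prop := RootedTree {
  rt_verts : (W `<=` verts S)%fset;
  rt_root : v \in W;
  rt_edges : (T `<=` edges S)%fset;
  rt_card : #|` W| = #|` T|.+1;
  rt_path : forall u, u \in W -> is_path S v (tau u) u;
  rt_path_edges : forall u, u \in W -> all (fun l => l.1 \in T) (tau u);
  rt_nil : tau v = [::];
  rt_ends : forall e, e \in T -> source e \in W /\ target e \in W;
  rt_compat : forall e, e \in T ->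
    free_eq (tau (source e) ++ [:: (e, true)]) (tau (target e)) }.

Lemma rooted_tree1 S v : v \in verts S ->
  rooted_tree S v [fset v]%fset fset0 (fun=> [::]).
Proof.
move=> hv; split=> //.
- by rewrite fsub1set.
- by rewrite in_fset1.
- by rewrite cardfs1 cardfs0.
- by move=> u; rewrite in_fset1 => /eqP ->; rewrite is_path_nil eqxx.
Qed.

Lemma rooted_tree_grow S v W T tau :
  rooted_tree S v W T tau ->
  (exists l, [/\ l.1 \in edges S, letter_start l \in W & letter_end l \notin W]) ->
  exists W' T' tau', rooted_tree S v W' T' tau' /\ #|` W'| = #|` W|.+1.
Proof.
move=> rt [l [he hs ht]].
set w := letter_end l in ht.
have heT : l.1 \notin T.
  apply/negP => /(rt_ends rt) [h1 h2].
  by move/negP: ht; apply; rewrite /w /letter_end; case: (l.2).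
pose tau' u := if u == w then tau (letter_start l) ++ [:: l] else tau u.
have tauW u : u \in W -> tau' u = tau u.
  by move=> hu; rewrite /tau'; case: eqP => // E; rewrite -E hu in ht.
exists (w |` W)%fset, (l.1 |` T)%fset, tau'; split; last by rewrite cardfsU1 ht.
split.
- by rewrite fsubUset fsub1set (rt_verts rt) andbT letter_endP.
- by rewrite in_fset1U (rt_root rt) orbT.
- by rewrite fsubUset fsub1set he (rt_edges rt).
- by rewrite !cardfsU1 ht heT (rt_card rt).
- move=> u; rewrite in_fset1U => /orP[/eqP ->|hu]; last first.
    by rewrite tauW //; exact: (rt_path rt).
  rewrite /tau' eqxx; apply: is_path_cat (rt_path rt hs) _.
  exact: is_path_edge.
- move=> u; rewrite in_fset1U => /orP[/eqP ->|hu].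
    rewrite /tau' eqxx all_cat /= in_fset1U eqxx /= andbT.
    apply: sub_all (rt_path_edges rt hs) => l' h.
    by rewrite in_fset1U h orbT.
  rewrite tauW //; apply: sub_all (rt_path_edges rt hu) => l' h.
  by rewrite in_fset1U h orbT.
- by rewrite tauW ?(rt_root rt) // (rt_nil rt).
- move=> e; rewrite in_fset1U => /orP[/eqP ->|/(rt_ends rt)[h1 h2]]; last first.
    by rewrite !in_fset1U h1 h2 !orbT.
  move: hs ht; rewrite /w /letter_start /letter_end !in_fset1U.
  by case: (l.2) => -> _; rewrite eqxx !orbT.
- move=> e; rewrite in_fset1U => /orP[/eqP ->|hT]; last first.
    by have [h1 h2] := rt_ends rt hT; rewrite !tauW //; exact: (rt_compat rt).
  move: hs ht tauW; rewrite /tau' /w /letter_start /letter_end.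
  case: (l) => a [] /= hs ht tauW.
    rewrite eqxx; case: eqP => [E|_]; first by rewrite -E hs in ht.
    exact: word_eq_refl.
  rewrite eqxx; case: eqP => [E|_]; first by rewrite -E hs in ht.
  rewrite -catA -{2}[tau (target a)]cats0; apply: word_eq_catl.
  exact: (@word_eq_cancel _ _ [::] [::] a false).
Qed.

Lemma spanning_tree S v : connected_subgraph S -> v \in verts S ->
  exists T tau, rooted_tree S v (verts S) T tau.
Proof.
move=> [_ hS] hv.
suff main k : (k < #|` verts S|)%N ->
    exists W T tau, rooted_tree S v W T tau /\ #|` W| = k.+1.
  have hpos : (0 < #|` verts S|)%N by rewrite cardfs_gt0; apply/fset0Pn; exists v.
  have [|W [T [tau [rt hW]]]] := main #|` verts S|.-1; first by rewrite prednK.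
  exists T, tau; rewrite prednK // in hW.
  suff -> : verts S = W by [].
  by apply: esym; apply/eqP; rewrite eqEfcard (rt_verts rt) hW leqnn.
elim: k => [_|k IH hk].
  exists [fset v]%fset, fset0, (fun=> [::]).
  by rewrite cardfs1; split=> //; exact: rooted_tree1.
have [W [T [tau [rt hW]]]] := IH (ltnW hk).
suff [u hu huW] : exists2 u, u \in verts S & u \notin W.
  have [p hp] := hS v u hv hu.
  have [W' [T' [tau' [rt' hW']]]] :=
    rooted_tree_grow rt (crossing_edge hp (rt_root rt) huW).
  by exists W', T', tau'; rewrite hW' hW.
have /fsubsetPn [u hu huW] : ~~ (verts S `<=` W)%fset; last by exists u.
by apply/negP => /fsubset_leq_card; rewrite hW leqNgt hk.
Qed.

Section TreeBasis.
Variables (S : finsubgraph Gm) (v : vertex Gm) (T : {fset edge Gm}).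
Variable tau : vertex Gm -> word (edge Gm).
Hypothesis rt : rooted_tree S v (verts S) T tau.

Let D := (edges S `\` T)%fset.

Lemma card_tree_complement : (#|` D| + #|` verts S| = #|` edges S| + 1)%N.
Proof.
rewrite /D cardfsD (fsetIidPr (rt_edges rt)) (rt_card rt).
by have := fsubset_leq_card (rt_edges rt); lia.
Qed.

Let loop e := tau (source e) ++ [:: (e, true)] ++ inv_word (tau (target e)).

(** The loop at the root that runs inside the tree except that it traverses the
    [i]-th edge outside the tree once. *)
Definition tree_loop (i : 'I_#|` D|) : word (edge Gm) :=
  loop (tnth (in_tuple (enum_fset D)) i).

(** Collapsing the tree: an edge outside [T] becomes its index. *)
Definition collapse e : word 'I_#|` D| :=
  if @insub nat (fun i => (i < #|` D|)%N) _ (index e (enum_fset D)) is Some i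
  then [:: (i, true)] else [::].

Lemma collapse_tree e : e \in T -> collapse e = [::].
Proof.
move=> he; rewrite /collapse insubF //; apply/negbTE.
by rewrite index_mem /D !inE he.
Qed.

Lemma collapse_tnth i : collapse (tnth (in_tuple (enum_fset D)) i) = [:: (i, true)].
Proof.
have hi : index (tnth (in_tuple (enum_fset D)) i) (enum_fset D) = i.
  case: i => i hi.
  rewrite (tnth_nth (tnth (in_tuple (enum_fset D)) (Ordinal hi))) /=.
  by rewrite index_uniq ?fset_uniq.
rewrite /collapse hi insubT // => h; congr [:: (_, _)].
exact: val_inj.
Qed.

Lemma wsub_collapse_tree p : all (fun l => l.1 \in T) p -> wsub collapse p = [::].
Proof.
elim: p => [|[e b] p IH] //= /andP[he /IH h].
by rewrite wsub_cons h cats0 /= collapse_tree //; case: b.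
Qed.

Lemma collapse_loop i : wsub collapse (tree_loop i) = [:: (i, true)].
Proof.
have [hD _] : tnth (in_tuple (enum_fset D)) i \in edges S /\ True.
  by have := mem_tnth i (in_tuple (enum_fset D)); rewrite /= !inE => /andP[].
have [h1 h2] := edge_endsP hD.
rewrite /tree_loop /loop !wsub_cat wsub_inv.
rewrite !(wsub_collapse_tree (rt_path_edges rt _)) //.
rewrite -[inv_word [::]]/([::]) wsub_cons /= !cats0.
exact: collapse_tnth.
Qed.

(** Up to backtracks, an edge is the corresponding product of loops, once its
    ends are joined to the root inside the tree. *)
Lemma loop_edge e : e \in edges S ->
  free_eq (tau (source e) ++ [:: (e, true)])
          (wsub tree_loop (collapse e) ++ tau (target e)).
Proof.
move=> he.
have [hT|hT] := boolP (e \in T).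
  by rewrite collapse_tree //; exact: (rt_compat rt).
have hD : e \in enum_fset D by rewrite !inE he hT.
have hi : (index e (enum_fset D) < #|` D|)%N by rewrite index_mem.
have E : tnth (in_tuple (enum_fset D)) (Ordinal hi) = e.
  by rewrite (tnth_nth e) /= nth_index.
have -> : collapse e = [:: (Ordinal hi, true)] by rewrite -{1}E collapse_tnth.
rewrite wsub_cons /= cats0 /tree_loop E /loop -!catA.
apply: word_eq_catl; apply: (@word_eq_catl _ _ [:: (e, true)] [::]).
exact/word_eq_sym/word_eqVl.
Qed.

Lemma path_tree_loops u q u' : is_path S u q u' ->
  free_eq (tau u ++ q) (wsub tree_loop (wsub collapse q) ++ tau u').
Proof.
elim: q u => [u /andP[/eqP -> _]|[e b] q IH u].
  by rewrite cats0; exact: word_eq_refl.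
rewrite is_path_cons => /and3P[/= he /eqP <- /IH h].
rewrite wsub_cons wsub_cat -catA.
apply: word_eq_trans (word_eq_catl _ h).
rewrite -cat1s !catA; apply: word_eq_catr.
have hl := loop_edge he.
case: b {h} => //=; rewrite /letter_start /letter_end /= wsub_inv.
set P := wsub _ _ in hl *.
apply/word_eq_mulV; rewrite inv_word_cat inv_wordK -!catA.
apply: word_eq_trans (_ : free_eq (tau (target e) ++ ([:: (e, false)] ++
   inv_word (tau (source e)) ++ P)) (tau (target e) ++ inv_word (tau (target e)))) _.
  apply: word_eq_catl.
  have hl' := word_eq_inv hl.
  rewrite !inv_word_cat in hl'.
  apply: word_eq_trans (_ : free_eq ((inv_word (tau (target e)) ++ inv_word P) ++ P) _).
    by rewrite catA; exact: word_eq_catr hl'.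
  rewrite -catA -{2}[inv_word (tau _)]cats0; apply: word_eq_catl.
  exact: word_eqVl.
exact: word_eqV.
Qed.

(** Collapsing the tree inverts the substitution of the loops, whence the
    freeness. *)
Lemma tree_basis : pi1_basis S v tree_loop.
Proof.
have hv := rt_root rt.
split=> [i|q hq|w hw].
- have hD : tnth (in_tuple (enum_fset D)) i \in edges S.
    by have := mem_tnth i (in_tuple (enum_fset D)); rewrite /= !inE => /andP[].
  have [h1 h2] := edge_endsP hD.
  apply: is_path_cat (rt_path rt h1) _.
  apply: is_path_cat (is_path_inv (rt_path rt h2)).
  exact: (@is_path_edge S (_, true)).
- exists (wsub collapse q); rewrite subst_wordE.
  by have := path_tree_loops hq; rewrite (rt_nil rt) cats0.
- have := wsub_free_eq collapse hw.
  rewrite subst_wordE wsub_comp.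
  suff -> : wsub (fun i => wsub collapse (tree_loop i)) w = w by [].
  rewrite -[RHS]wsub_id; congr wsub.
  by apply/funext => i; exact: collapse_loop.
Qed.

End TreeBasis.

Lemma pi1_basis_rank_le S v r s (p : 'I_r -> word (edge Gm))
    (t : 'I_s -> word (edge Gm)) :
  pi1_basis S v p -> pi1_basis S v t -> (r <= s)%N.
Proof.
move=> [p1 p2 p3] [t1 t2 t3].
have /choice [f hf] : forall i, exists b, free_eq (p i) (wsub t b).
  by move=> i; exact: t2 (p1 i).
have /choice [g hg] : forall i, exists b, free_eq (t i) (wsub p b).
  by move=> i; exact: p2 (t1 i).
apply: (@free_retract_rank r s f g) => i.
apply/word_eq_mulV/p3; rewrite subst_wordE wsub_cat wsub_inv.
apply/word_eq_mulV; rewrite wsub_comp wsub_cons /= cats0.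
apply: word_eq_sym; apply: word_eq_trans (hf i) _.
exact: wsub_ext.
Qed.

Lemma component_connected S v : connected_subgraph S -> v \in verts S ->
  component S v = verts S.
Proof.
move=> [_ hS] hv; apply/fsetP => u; rewrite !inE /=.
apply/andP/idP => [[]//|hu]; split=> //.
by apply/asboolP; exact: hS.
Qed.

Lemma components_connected S : connected_subgraph S ->
  components S = [fset verts S]%fset.
Proof.
move=> hS; have [/fset0Pn [v hv] _] := hS.
apply/fsetP => C; rewrite in_fset1; apply/imfsetP/eqP => [[u /= hu ->]|->].
  exact: component_connected.
by exists v => //; rewrite component_connected.
Qed.

(** The base point and the basis are arbitrary: each basis is compared with the
    basis given by a spanning tree at the same base point. *)
Lemma pi1_rank_unique S v r (p : 'I_r -> word (edge Gm)) :
  connected_subgraph S -> v \in verts S -> pi1_basis S v p ->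
  beta2 S = r.
Proof.
move=> hS hv hp.
have rk s u (t : 'I_s -> word (edge Gm)) : u \in verts S -> pi1_basis S u t ->
    (s + #|` verts S| = #|` edges S| + 1)%N.
  move=> hu ht; have [T [tau rt]] := spanning_tree hS hu.
  rewrite -(card_tree_complement rt); congr (_ + _)%N.
  by have b := tree_basis rt; apply/eqP; rewrite eqn_leq
    (pi1_basis_rank_le b ht) (pi1_basis_rank_le ht b).
rewrite /beta2 components_connected // big_seq_fset1 /pi1_rank.
apply: xget_unique => [|s [u hu [t ht]]]; first by exists v => //; exists p.
by have := rk _ _ _ hu ht; have := rk _ _ _ hv hp; lia.
Qed.

Lemma beta2_connected S : connected_subgraph S ->
  (beta2 S + beta0 S = #|` edges S| + 1)%N.
Proof.
move=> hS; have [/fset0Pn [v hv] _] := hS.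
have [T [tau rt]] := spanning_tree hS hv.
by rewrite (pi1_rank_unique hS hv (tree_basis rt)) (card_tree_complement rt).
Qed.

End Paths.

(** * Finite subsets of a group *)

Section FsetGroup.
Variable G : groupType.
Implicit Types (A B C F : {fset G}) (g h : G).

Lemma cardfsM (T1 T2 : choiceType) (A : {fset T1}) (B : {fset T2}) :
  #|` (A `*` B)%fset| = (#|` A| * #|` B|)%N.
Proof.
rewrite /fsetM Imfset.imfset2E /= size_seq_fset undup_id ?size_allpairs //.
by apply: allpairs_uniq => //; [case=> a b [c d]].
Qed.

(** The set of products of an element of [A] and an element of [B]. *)
Definition fset_mulg A B : {fset G} := [fset (a * b)%g | a in A, b in B]%fset.

Lemma fset_mulgP A B g :
  reflect (exists a b, [/\ a \in A, b \in B & g = (a * b)%g]) (g \in fset_mulg A B).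
Proof.
apply: (iffP (imfset2P _ _ _ _ _)) => [[a /= ha [b /= hb ->]]|[a [b [ha hb ->]]]].
  by exists a, b.
by exists a => //; exists b.
Qed.

Lemma mem_fset_mulg A B a b : a \in A -> b \in B -> (a * b)%g \in fset_mulg A B.
Proof. by move=> ha hb; apply/fset_mulgP; exists a, b. Qed.

Lemma fset_mulgA A B C :
  fset_mulg A (fset_mulg B C) = fset_mulg (fset_mulg A B) C.
Proof.
apply/fsetP => g; apply/fset_mulgP/fset_mulgP.
  move=> [a [_ [ha /fset_mulgP [b [c [hb hc ->]]] ->]]].
  by exists (a * b)%g, c; rewrite mulgA; split=> //; exact: mem_fset_mulg.
move=> [_ [c [/fset_mulgP [a [b [ha hb ->]]] hc ->]]].
by exists a, (b * c)%g; rewrite mulgA; split=> //; exact: mem_fset_mulg.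
Qed.

Lemma fset_mulg1 A : fset_mulg A [fset 1%g]%fset = A.
Proof.
apply/fsetP => g; apply/fset_mulgP/idP.
  by move=> [a [b [ha]]]; rewrite in_fset1 => /eqP -> ->; rewrite mulg1.
by move=> hg; exists g, 1%g; rewrite in_fset1 eqxx mulg1.
Qed.

Lemma card_fset_mulg A B : (#|` fset_mulg A B| <= #|` A| * #|` B|)%N.
Proof.
have -> : fset_mulg A B = [fset (p.1 * p.2)%g | p in (A `*` B)%fset]%fset.
  apply/fsetP => g; apply/fset_mulgP/imfsetP.
    move=> [a [b [ha hb ->]]]; exists (a, b) => //=.
    by rewrite in_fsetM ha hb.
  by move=> [[a b] /=]; rewrite in_fsetM => /andP[ha hb] ->; exists a, b.
by rewrite -cardfsM; exact: leq_imfset_card.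
Qed.

(** Left translate. *)
Definition ltrans g A : {fset G} := [fset (g * a)%g | a in A]%fset.

Lemma mem_ltrans g A h : (h \in ltrans g A) = ((g^-1 * h)%g \in A).
Proof.
apply/imfsetP/idP => [[a /= ha ->]|hh]; first by rewrite mulKg.
by exists (g^-1 * h)%g => //; rewrite mulVKg.
Qed.

Lemma card_ltrans g A : #|` ltrans g A| = #|` A|.
Proof. by rewrite card_imfset //; exact: mulgI. Qed.

(** A greedy choice: each chosen element [a] excludes at most the [#|` B|]
    elements of its neighbourhood [a * B]. *)
Lemma separated_subset A B :
  1%g \in B -> (forall b, b \in B -> (b^-1)%g \in B) ->
  exists M, [/\ (M `<=` A)%fset, (#|` A| <= #|` M| * #|` B|)%N &
    forall g h, g \in M -> h \in M -> (g^-1 * h)%g \in B -> g = h].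
Proof.
move=> hB hV.
have [k] := ubnP #|` A|; elim: k A => // k IH A hA.
have [->|/fset0Pn [a ha]] := eqVneq A fset0.
  by exists fset0; split=> //; rewrite cardfs0.
have hE := cardfsID (ltrans a B) A.
have h0 : (0 < #|` A `&` ltrans a B|)%fset%N.
  by rewrite cardfs_gt0; apply/fset0Pn; exists a; rewrite in_fsetI ha mem_ltrans mulVg.
have h1 : (#|` A `&` ltrans a B| <= #|` B|)%fset%N.
  by rewrite -(card_ltrans a B) fsubset_leq_card // fsubsetIr.
have [|M [hM hc hs]] := IH (A `\` ltrans a B)%fset; first by lia.
have far h : h \in M -> (a^-1 * h)%g \notin B.
  by move=> /(fsubsetP hM); rewrite in_fsetD mem_ltrans => /andP[].
exists (a |` M)%fset; split.
- rewrite fsubUset fsub1set ha; apply: fsubset_trans hM _; exact: fsubsetDl.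
- rewrite cardfsU1; suff -> : a \notin M by rewrite mulnDl mul1n; lia.
  by apply/negP => /far; rewrite mulVg hB.
move=> g h; rewrite !in_fset1U => /orP[/eqP ->|hg] /orP[/eqP ->|hh] //.
- by move=> H; have := far _ hh; rewrite H.
- by move/hV; rewrite invgM invgK => H; have := far _ hg; rewrite H.
- exact: hs.
Qed.

End FsetGroup.

(** * Finite subgraphs of a Cayley graph *)

Section Cayley.
Variables (G : groupType) (n : nat) (x : 'I_n -> G).
Implicit Types (F : {fset G}) (g h : G) (w u v : word 'I_n).

Notation Cay := (cayley_graph x).

Definition letter_val (l : 'I_n * bool) : G := if l.2 then x l.1 else (x l.1)^-1%g.

(** The traversed edge that leaves [g] with label [l]. *)
Definition edge_at g (l : 'I_n * bool) : edge Cay * bool :=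
  ((if l.2 then g else g * (x l.1)^-1, l.1), l.2)%g.

Lemma start_edge_at g l : letter_start (edge_at g l) = g.
Proof. by case: l => j []; rewrite /letter_start //= mulgVK. Qed.

Lemma end_edge_at g l : letter_end (edge_at g l) = (g * letter_val l)%g.
Proof. by case: l => j []. Qed.

(** The path from [g] in the Cayley graph with label [w]. *)
Fixpoint cpath g w : word (edge Cay) :=
  if w is l :: w' then edge_at g l :: cpath (g * letter_val l)%g w' else [::].

Lemma cpath_cat g u v : cpath g (u ++ v) = cpath g u ++ cpath (g * eval_word x u)%g v.
Proof.
elim: u g => [|l u IH] g /=; first by rewrite eval_nil mulg1.
by rewrite IH eval_cons mulgA.
Qed.

Lemma cpath_ltrans h g w :
  cpath (h * g)%g w = [seq ((h * l.1.1, l.1.2), l.2)%g | l <- cpath g w].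
Proof.
elim: w g => [|[a b] w IH] g //=; rewrite -(mulgA h g (letter_val _)) IH; congr (_ :: _).
by case: b; rewrite //= mulgA.
Qed.

Lemma cpath_free_eq g u v : free_eq u v -> free_eq (cpath g u) (cpath g v).
Proof.
move=> h; elim: h g => {u v} [u|u v _ IH|u v w _ IH1 _ IH2|u v a b|u v r []] g.
- exact: word_eq_refl.
- exact/word_eq_sym/IH.
- exact: word_eq_trans (IH1 g) (IH2 g).
rewrite !cpath_cat; apply: word_eq_catl; set g' := (g * _)%g => /=.
rewrite !eval_cons eval_nil mulg1 /edge_at /letter_val.
case: b => /=; rewrite ?mulgV ?mulVg ?mulgK mulg1.
  exact: (@word_eq_cancel _ _ [::] _ (g', a) true).
exact: (@word_eq_cancel _ _ [::] _ (g' * (x a)^-1, a)%g false).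
Qed.

Definition label (p : word (edge Cay)) : word 'I_n := [seq (l.1.2, l.2) | l <- p].

Lemma edge_at_label (l : edge Cay * bool) :
  edge_at (letter_start l) (l.1.2, l.2) = l.
Proof. by case: l => [[a j] []]; rewrite /edge_at /letter_start //= mulgK. Qed.

(** Every edge path is determined by its origin and its label. *)
Lemma path_cpath (S : finsubgraph Cay) g p h : is_path S g p h ->
  p = cpath g (label p) /\ h = (g * eval_word x (label p))%g.
Proof.
elim: p g => [|l p IH] g.
  by rewrite is_path_nil => /andP[/eqP -> _]; rewrite eval_nil mulg1.
rewrite is_path_cons => /and3P[_ /eqP <- /IH [hp hh]].
have E : letter_end l = (letter_start l * letter_val (l.1.2, l.2))%g.
  by rewrite -end_edge_at edge_at_label.
split; first by rewrite [RHS]/= edge_at_label -E -hp.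
by rewrite hh E -mulgA eval_cons.
Qed.

Lemma cpath_path (S : finsubgraph Cay) g w : g \in verts S ->
  all (fun l => l.1 \in edges S) (cpath g w) ->
  is_path S g (cpath g w) (g * eval_word x w)%g.
Proof.
elim: w g => [|[j b] w IH] g hg.
  by rewrite is_path_nil eval_nil mulg1 eqxx.
move=> /andP[he hw]; rewrite is_path_cons he start_edge_at eqxx /=.
rewrite end_edge_at eval_cons mulgA; apply: IH hw.
by rewrite -end_edge_at; exact: letter_endP.
Qed.

(** The edges with both ends in [F]. *)
Definition induced_edges F : {fset edge Cay} :=
  [fset e in (F `*` [fset i in 'I_n])%fset | (e.1 * x e.2)%g \in F]%fset.

Lemma in_induced_edges F (e : edge Cay) :
  (e \in induced_edges F) = (e.1 \in F) && ((e.1 * x e.2)%g \in F).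
Proof. by rewrite !inE /= andbT. Qed.

Lemma induced_closed F :
  all (fun e : edge Cay => (source e \in (F : {fset vertex Cay})) && (target e \in F))
      (induced_edges F).
Proof. by apply/allP => e; rewrite in_induced_edges. Qed.

(** The full subgraph on a finite set of vertices. *)
Definition full_sub F : finsubgraph Cay := FinSubgraph (induced_closed F).

Lemma induced_sub F F' : (F `<=` F')%fset -> subgraph_le (full_sub F) (full_sub F').
Proof.
move=> h; split=> //=; apply/fsubsetP => e; rewrite !in_induced_edges.
by move=> /andP[/(fsubsetP h) -> /(fsubsetP h) ->].
Qed.

Lemma edges_induced (S : finsubgraph Cay) : (edges S `<=` induced_edges (verts S))%fset.
Proof.
by apply/fsubsetP => e /edge_endsP [h1 h2]; rewrite in_induced_edges; apply/andP.
Qed.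

(** The number of edges with initial vertex in [F]. *)
Lemma card_outgoing F : #|` (F `*` [fset i in 'I_n])%fset| = (#|` F| * n)%N.
Proof. by rewrite cardfsM card_finset card_ord. Qed.

Lemma card_induced_edges F : (#|` induced_edges F| <= #|` F| * n)%N.
Proof.
rewrite -card_outgoing; apply: fsubset_leq_card; apply/fsubsetP => e.
by rewrite in_induced_edges !inE /= => /andP[->].
Qed.

Lemma card_edges (S : finsubgraph Cay) : (#|` edges S| <= beta0 S * n)%N.
Proof.
exact: leq_trans (fsubset_leq_card (edges_induced S)) (card_induced_edges _).
Qed.

Lemma card_induced_ltrans g F :
  #|` induced_edges (ltrans g F)| = #|` induced_edges F|.
Proof.
have -> : induced_edges (ltrans g F) =
    [fset ((g * e.1)%g, e.2) | e in induced_edges F]%fset.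
  apply/fsetP => -[h j]; rewrite in_induced_edges !mem_ltrans /= mulgA.
  apply/idP/imfsetP => [hh|[[h' j'] /=]].
    exists ((g^-1 * h)%g, j); first by rewrite in_induced_edges.
    by rewrite /= mulVKg.
  by rewrite in_induced_edges /= => hh [-> ->]; rewrite !mulKg.
by rewrite card_imfset // => -[a b] [c d] [/mulgI -> ->].
Qed.

Definition sub_union (S T : finsubgraph Cay) : finsubgraph Cay.
Proof.
refine (@FinSubgraph Cay (verts S `|` verts T)%fset (edges S `|` edges T)%fset _).
apply/allP => e; rewrite !in_fsetU => /orP[] /edge_endsP [-> ->] //.
by rewrite !orbT.
Defined.

Lemma sub_unionl (S T : finsubgraph Cay) : subgraph_le S (sub_union S T).
Proof. by split; exact: fsubsetUl. Qed.

Lemma sub_unionr (S T : finsubgraph Cay) : subgraph_le T (sub_union S T).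
Proof. by split; exact: fsubsetUr. Qed.

Lemma sub_union_connected (S T : finsubgraph Cay) (g : vertex Cay) :
  connected_subgraph S -> connected_subgraph T -> g \in verts S -> g \in verts T ->
  connected_subgraph (sub_union S T).
Proof.
move=> [_ hS] [_ hT] gS gT; apply: (@connected_of_root _ _ g).
  by rewrite in_fsetU gS.
move=> u; rewrite in_fsetU => /orP[hu|hu].
  exact: joined_sub (sub_unionl S T) (hS _ _ hu gS).
exact: joined_sub (sub_unionr S T) (hT _ _ hu gT).
Qed.

Lemma subgraph_le_refl (S : finsubgraph Cay) : subgraph_le S S.
Proof. by split. Qed.

Lemma subgraph_le_trans (S T U : finsubgraph Cay) :
  subgraph_le S T -> subgraph_le T U -> subgraph_le S U.
Proof.
by move=> [h1 h2] [h3 h4]; split; [exact: fsubset_trans h3|exact: fsubset_trans h4].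
Qed.

(** ** Balls of the word metric *)

(** The generators and their inverses. *)
Definition letters : {fset G} :=
  [fset letter_val l | l in [fset l in {: 'I_n * bool}]]%fset.

(** The ball of radius [k] about the identity. *)
Definition wball k : {fset G} :=
  iter k (fun B => fset_mulg B (1%g |` letters)%fset) [fset 1%g]%fset.

Lemma letterP g : reflect (exists l, g = letter_val l) (g \in letters).
Proof.
apply: (iffP (imfsetP _ _ _ _)) => [[l /= _ ->]|[l ->]]; exists l => //=.
by rewrite !inE.
Qed.

Lemma wballS k : wball k.+1 = fset_mulg (wball k) (1%g |` letters)%fset.
Proof. by []. Qed.

Lemma wball_step k g l : g \in wball k -> (g * letter_val l)%g \in wball k.+1.
Proof.
move=> hg; rewrite wballS; apply: mem_fset_mulg => //.
by rewrite in_fset1U; apply/orP; right; apply/letterP; exists l.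
Qed.

Lemma wball_subS k : (wball k `<=` wball k.+1)%fset.
Proof.
apply/fsubsetP => g hg; rewrite wballS -[g]mulg1; apply: mem_fset_mulg => //.
by rewrite in_fset1U eqxx.
Qed.

Lemma wball_sub k m : (k <= m)%N -> (wball k `<=` wball m)%fset.
Proof.
move=> /subnK <-; elim: (m - k)%N => [|d IH]; first exact: fsubset_refl.
by rewrite addSn; exact: fsubset_trans IH (wball_subS _).
Qed.

Lemma wballD k m : wball (k + m) = fset_mulg (wball k) (wball m).
Proof.
elim: m => [|m IH]; first by rewrite addn0 fset_mulg1.
by rewrite addnS !wballS IH fset_mulgA.
Qed.

Lemma wball1 k : 1%g \in wball k.
Proof.
by apply: (fsubsetP (wball_sub (leq0n k))); rewrite in_fset1.
Qed.

Lemma wballP k g :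
  reflect (exists2 w, (size w <= k)%N & eval_word x w = g) (g \in wball k).
Proof.
apply: (iffP idP).
  elim: k g => [|k IH] g.
    by rewrite in_fset1 => /eqP ->; exists [::] => //; exact: eval_nil.
  move=> /fset_mulgP [a [b [/IH [w hw <-]]]].
  rewrite in_fset1U => /orP[/eqP ->|/letterP [l ->]] ->.
    by exists w; rewrite ?mulg1 // ltnW.
  exists (w ++ [:: l]); first by rewrite size_cat addn1.
  by rewrite eval_cat eval_cons eval_nil mulg1.
move=> [w hw <-]; apply: (fsubsetP (wball_sub hw)) => {k g hw}.
elim/last_ind: w => [|w l IH]; first by rewrite eval_nil in_fset1.
rewrite size_rcons -cats1 eval_cat eval_cons eval_nil mulg1.
exact: (wball_step l IH).
Qed.

Lemma wballV k g : g \in wball k -> (g^-1)%g \in wball k.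
Proof.
move=> /wballP [w hw <-]; apply/wballP; exists (inv_word w); last exact: eval_inv.
by rewrite size_rev size_map.
Qed.

Lemma wball_connected k : connected_subgraph (full_sub (wball k)).
Proof.
apply: (@connected_of_root Cay _ (1%g : G)); first exact: wball1.
elim: k => [|k IH] g /=.
  by rewrite in_fset1 => /eqP ->; apply: joined_refl; exact: (wball1 0).
have sub := induced_sub (wball_subS k).
move=> /fset_mulgP [a [b [ha]]].
rewrite in_fset1U => /orP[/eqP ->|/letterP [l ->]] ->.
  by rewrite mulg1; exact: joined_sub sub (IH a ha).
apply: joined_trans (joined_sub sub (IH a ha)).
apply: joined_sym; exists [:: edge_at a l].
have h1 := wball_step l ha; have h2 := fsubsetP (wball_subS k) _ ha.
have hE : (edge_at a l).1 \in induced_edges (wball k.+1).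
  rewrite in_induced_edges; move: h1.
  by case: l => j [] /= h1; rewrite ?mulgVK h2 h1.
rewrite is_path_cons start_edge_at end_edge_at is_path_nil !eqxx /=.
by rewrite [X in X && _]hE; exact: h1.
Qed.

Lemma cpath_in_induced k g w : g \in wball k ->
  all (fun l => l.1 \in edges (full_sub (wball (k + size w)))) (cpath g w).
Proof.
elim: w k g => [|l w IH] k g hg //=.
rewrite -addSnnS IH ?andbT; last exact: wball_step.
have h1 := fsubsetP (wball_sub (leq_addr (size w) k.+1)) _ (wball_step l hg).
have h2 := fsubsetP (wball_sub (leq_trans (leqnSn k) (leq_addr (size w) k.+1))) _ hg.
rewrite in_induced_edges; move: h1.
by case: l => j [] /= h1; rewrite ?mulgVK h2 h1.
Qed.

Lemma card_wballD k m : (#|` wball (k + m)| <= #|` wball k| * #|` wball m|)%N.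
Proof. by rewrite wballD; exact: card_fset_mulg. Qed.

(** ** Exhausting chains *)

Hypothesis gen : forall g, exists w, eval_word x w = g.

Lemma wball_cover g : exists k, g \in wball k.
Proof. by have [w hw] := gen g; exists (size w); apply/wballP; exists w. Qed.

(** An extension property of connected subgraphs, applied in turn after adding
    larger and larger balls, produces an exhausting chain. *)
Lemma chain_builder (P : nat -> finsubgraph Cay -> Prop) :
  (forall k T, connected_subgraph T -> (1%g : vertex Cay) \in verts T ->
     exists S, [/\ subgraph_le T S, connected_subgraph S & P k S]) ->
  exists S, exhausting_chain S /\ forall k, P k (S k).
Proof.
move=> hP.
have /choice [f hf] : forall kT : nat * finsubgraph Cay, exists S,
    connected_subgraph kT.2 -> (1%g : vertex Cay) \in verts kT.2 ->
    [/\ subgraph_le kT.2 S, connected_subgraph S & P kT.1 S].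
  move=> [k T]; have [hc|hc] := pselect (connected_subgraph T); last by exists T.
  have [h1|h1] := boolP ((1%g : vertex Cay) \in verts T); last by exists T.
  by have [S hS] := hP k T hc h1; exists S.
pose B k := full_sub (wball k).
pose S := fix S k := if k is k'.+1 then f (k, sub_union (S k') (B k)) else f (k, B k).
have main k : [/\ connected_subgraph (S k), subgraph_le (B k) (S k) & P k (S k)].
  elim: k => [|k [h1 h2 h3]] /=.
    have [|h1 h2 h3] := hf (0%N, B 0%N) (wball_connected 0); first exact: wball1.
    by split.
  have one : (1%g : vertex Cay) \in verts (S k).
    by apply: (fsubsetP h2.1); exact: wball1.
  have [||h4 h5 h6] := hf (k.+1, sub_union (S k) (B k.+1)).
  - apply: sub_union_connected h1 (wball_connected _) one _; exact: wball1.
  - by rewrite in_fsetU one.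
  by split=> //; apply: subgraph_le_trans (sub_unionr _ _) h4.
exists S; split; last by move=> k; case: (main k).
split.
- by move=> k; case: (main k).
- move=> k /=; have [h1 h2 h3] := main k.
  have one : (1%g : vertex Cay) \in verts (S k).
    by apply: (fsubsetP h2.1); exact: wball1.
  have [||h4 h5 h6] := hf (k.+1, sub_union (S k) (B k.+1)).
  - apply: sub_union_connected h1 (wball_connected _) one _; exact: wball1.
  - by rewrite in_fsetU one.
  exact: subgraph_le_trans (sub_unionl _ _) h4.
- move=> v; have [k hk] := wball_cover v; exists k.
  by have [_ h _] := main k; apply: (fsubsetP h.1).
move=> [g j]; have [k hk] := wball_cover g; exists k.+1.
have [_ h _] := main k.+1; apply: (fsubsetP h.2).
rewrite in_induced_edges /= (wball_step (j, true) hk).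
by rewrite (fsubsetP (wball_subS k)).
Qed.

Lemma chain_sub (S : nat -> finsubgraph Cay) i k : exhausting_chain S ->
  (i <= k)%N -> subgraph_le (S i) (S k).
Proof.
move=> [_ h _ _] /subnK <-; elim: (k - i)%N => [|d IH]; first exact: subgraph_le_refl.
exact: subgraph_le_trans IH (h _).
Qed.

(** Every finite set of vertices is eventually covered. *)
Lemma chain_cover (S : nat -> finsubgraph Cay) F : exhausting_chain S ->
  exists N, forall i, (N <= i)%N -> (F `<=` verts (S i))%fset.
Proof.
move=> hS; have [_ _ hv _] := hS.
elim/finSet_rect: F => F IH.
have [->|/fset0Pn [a ha]] := eqVneq F fset0; first by exists 0%N => i _; exact: fsub0set.
have [|N hN] := IH (F `\ a)%fset; first by rewrite fproperD1.
have [m hm] := hv a; exists (maxn N m) => i; rewrite geq_max => /andP[hi1 hi2].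
rewrite -(fsetD1K ha) fsubUset fsub1set hN // andbT.
exact: (fsubsetP (chain_sub hS hi2).1).
Qed.

End Cayley.

(** * Limits superior *)

Section Limsup.
Variable R : realType.
Implicit Types (u : nat -> \bar R) (c : R).

Lemma limn_esup_ub u (c : \bar R) N :
  (forall i, (N <= i)%N -> (u i <= c)%E) -> (limn_esup u <= c)%E.
Proof.
move=> h; rewrite /limn_esup /limf_esup; apply: ge_ereal_inf.
exists (ereal_sup (u @` [set i | (N <= i)%N])%classic).
  by exists [set i | (N <= i)%N]%classic => //; exact: nbhs_infty_ge.
by apply: ge_ereal_sup => _ [i /= hi <-]; exact: h.
Qed.

Lemma limn_esup_lb u (c : \bar R) :
  (forall N, exists2 i, (N <= i)%N & (c <= u i)%E) -> (c <= limn_esup u)%E.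
Proof.
move=> h; rewrite /limn_esup /limf_esup; apply: le_ereal_inf_tmp => _ [V [N _ hV] <-].
have [i hi hc] := h N; apply: le_ereal_sup_tmp; exists (u i) => //.
by exists i => //; exact: hV.
Qed.

Lemma limn_esup_ub_eps u c :
  (forall e : R, 0 < e -> exists N, forall i, (N <= i)%N -> (u i <= (c + e)%:E)%E) ->
  (limn_esup u <= c%:E)%E.
Proof.
move=> h; apply/lee_addgt0Pr => e he; have [N hN] := h e he.
by rewrite -EFinD; exact: limn_esup_ub hN.
Qed.

Lemma limn_esup_lb_eps u c :
  (forall e : R, 0 < e -> exists N, forall i, (N <= i)%N -> ((c - e)%:E <= u i)%E) ->
  (c%:E <= limn_esup u)%E.
Proof.
move=> h; apply/lee_addgt0Pr => e he; have [N hN] := h e he.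
rewrite -leeBlDr // -EFinB; apply: limn_esup_lb => m.
by exists (maxn m N); [exact: leq_maxl|apply: hN; exact: leq_maxr].
Qed.

End Limsup.

(** * Bounds on the cyclomatic quotient *)

Section Bounds.
Variables (R : realType) (G : groupType) (n : nat) (x : 'I_n -> G).
Notation Cay := (cayley_graph x).
Implicit Types (S T : finsubgraph Cay) (F : {fset G}).

Lemma beta0_gt0 S : connected_subgraph S -> (0 : R) < (beta0 S)%:R.
Proof. by move=> [h _]; rewrite ltr0n /beta0 cardfs_gt0. Qed.

Lemma xi_connected S : connected_subgraph S ->
  xi R S = (#|` edges S|%:R + 1) / (beta0 S)%:R - 1.
Proof.
move=> hS; have hV := beta0_gt0 hS.
have := congr1 (fun m : nat => m%:R : R) (beta2_connected hS).
rewrite /= !natrD /xi => h.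
by rewrite -h mulrDl divff ?gt_eqF // addrK.
Qed.

Lemma xi_ge0 S : 0 <= xi R S.
Proof. by rewrite /xi divr_ge0. Qed.

Lemma xi_le S : connected_subgraph S ->
  xi R S <= n%:R - 1 + (beta0 S)%:R^-1.
Proof.
move=> hS; have hV := beta0_gt0 hS; rewrite xi_connected // mulrDl div1r.
suff : #|` edges S|%:R / (beta0 S)%:R <= n%:R :> R by lra.
by rewrite ler_pdivrMr // -natrM ler_nat mulnC; exact: card_edges.
Qed.

Lemma inv_card_le1 : inv_card R G <= 1.
Proof.
rewrite /inv_card; case: ifP => // /asboolP h.
rewrite invf_le1 ?ler1n ?ltr0n cardfs_gt0; apply/fset0Pn; exists 1%g;
  by rewrite in_fset_set // inE.
Qed.

Lemma inv_card_finite : finite_set [set: G]%classic ->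
  inv_card R G = #|` fset_set [set: G]%classic|%:R^-1.
Proof. by move=> h; rewrite /inv_card ifT //; apply/asboolP. Qed.

Lemma inv_card_infinite : infinite_set [set: G]%classic -> inv_card R G = 0.
Proof. by move=> h; rewrite /inv_card ifF //; apply/asboolP. Qed.

(** Along an exhausting chain the inverse of the number of vertices tends to
    [1 / |G|]. *)
Lemma chain_beta0 (S : nat -> finsubgraph Cay) : exhausting_chain S ->
  forall e : R, 0 < e -> exists N, forall i, (N <= i)%N ->
    (beta0 (S i))%:R^-1 <= inv_card R G + e.
Proof.
move=> hS e he; have [hc _ _ _] := hS.
have [hG|hG] := pselect (finite_set [set: G]%classic).
  have [N hN] := chain_cover (fset_set [set: G]%classic) hS.
  exists N => i /hN hi; rewrite inv_card_finite //.
  have hpos : (0 < #|` fset_set [set: G]%classic|)%N.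
    by rewrite cardfs_gt0; apply/fset0Pn; exists 1%g; rewrite in_fset_set // inE.
  apply: (@le_trans _ _ #|` fset_set [set: G]%classic|%:R^-1); last by rewrite lerDl ltW.
  rewrite lef_pV2 ?posrE ?ltr0n ?ler_nat.
  - exact: fsubset_leq_card.
  - exact: leq_trans hpos (fsubset_leq_card hi).
  - exact: hpos.
rewrite inv_card_infinite // add0r.
have [F _ hF] := infinite_set_fset (Num.bound e^-1) hG.
have [N hN] := chain_cover F hS.
exists N => i /hN hi; rewrite -[leRHS]invrK lef_pV2 ?posrE ?invr_gt0 //;
  last exact: beta0_gt0.
apply: ltW; apply: lt_le_trans (archi_boundP _) _; first by rewrite invr_ge0 ltW.
by rewrite ler_nat; apply: leq_trans hF (fsubset_leq_card hi).
Qed.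

Lemma cyclomatic_quotient_ub (c : R) :
  (forall S : nat -> finsubgraph Cay, exhausting_chain S -> forall i,
      xi R (S i) <= c + (beta0 (S i))%:R^-1) ->
  (cyclomatic_quotient R x <= (c + inv_card R G)%:E)%E.
Proof.
move=> h; apply: ge_ereal_sup => _ [S hS <-].
apply: limn_esup_ub_eps => e he; have [N hN] := chain_beta0 hS he.
by exists N => i /hN hi; rewrite lee_fin; have := h S hS i; lra.
Qed.

Lemma cyclomatic_quotient_le :
  (cyclomatic_quotient R x <= (n%:R - 1 + inv_card R G)%:E)%E.
Proof.
by apply: cyclomatic_quotient_ub => S [hc _ _ _] i; exact: xi_le.
Qed.

(** The condition of Folner: there are finite sets that are almost invariant
    under right translation by the generators, in the sense that almost all of
    their [n * #|` F|] outgoing edges end in them. *)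
Definition folner : Prop := forall e : R, 0 < e ->
  exists2 F, F != fset0 & (n%:R - e) * #|` F|%:R <= #|` induced_edges x F|%:R.

Lemma finite_folner : finite_set [set: G]%classic -> folner.
Proof.
move=> hG e he; pose F := fset_set [set: G]%classic.
have inF g : g \in F by rewrite in_fset_set // inE.
exists F; first by apply/fset0Pn; exists 1%g.
have -> : induced_edges x F = (F `*` [fset i in 'I_n])%fset.
  by apply/fsetP => a; rewrite in_induced_edges !inE /= !inF.
rewrite card_outgoing natrM mulrC ler_wpM2l ?ler0n //; lra.
Qed.

Lemma not_folner_lt : ~ folner ->
  (cyclomatic_quotient R x < (n%:R - 1)%:E)%E.
Proof.
move=> hF.
have hG : infinite_set [set: G]%classic by move=> /finite_folner.
have [e he hE] : exists2 e : R, 0 < e & forall F, F != fset0 ->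
    #|` induced_edges x F|%:R < (n%:R - e) * #|` F|%:R.
  apply: contrapT => h; apply: hF => e he; apply: contrapT => h'; apply: h.
  exists e => // F h0; rewrite ltNge; apply/negP => hle.
  by apply: h'; exists F.
apply: (@le_lt_trans _ _ ((n%:R - 1 - e) + inv_card R G)%:E).
  apply: cyclomatic_quotient_ub => S [hc _ _ _] i.
  have hV := beta0_gt0 (hc i); rewrite xi_connected // mulrDl div1r.
  suff : #|` edges (S i)|%:R / (beta0 (S i))%:R <= n%:R - e by lra.
  rewrite ler_pdivrMr //; apply: le_trans (ltW (hE _ (hc i).1)).
  by rewrite ler_nat; exact: fsubset_leq_card (edges_induced _).
by rewrite inv_card_infinite // lte_fin; lra.
Qed.

Hypothesis gen : forall g, exists w, eval_word x w = g.

Lemma wball_chain : exhausting_chain (fun k => full_sub x (wball x k)).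
Proof.
split=> [k|k|g|[g j]].
- exact: wball_connected.
- exact/induced_sub/wball_subS.
- exact: wball_cover gen g.
have [k hk] := wball_cover gen g; exists k.+1.
rewrite in_induced_edges /= (wball_step (j, true) hk).
by rewrite (fsubsetP (wball_subS x k)).
Qed.

Lemma cyclomatic_quotient_lb (c : \bar R) (S : nat -> finsubgraph Cay) :
  exhausting_chain S -> (c <= limn_esup (fun i => (xi R (S i))%:E))%E ->
  (c <= cyclomatic_quotient R x)%E.
Proof.
move=> hS hc; apply: le_ereal_sup_tmp.
by exists (limn_esup (fun i => (xi R (S i))%:E)) => //; exists S.
Qed.

Lemma cyclomatic_quotient_ge0 : (0 <= cyclomatic_quotient R x)%E.
Proof.
apply: cyclomatic_quotient_lb wball_chain _; apply: limn_esup_lb => N.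
by exists N => //; rewrite lee_fin xi_ge0.
Qed.

(** ** Amenable case: chains of near-invariant sets *)

Section MinimalFolner.
Variables (c : R) (F : {fset G}).
Hypothesis F0 : F != fset0.
Hypothesis Fc : c * #|` F|%:R <= #|` induced_edges x F|%:R.
Hypothesis Fmin : forall F', F' != fset0 ->
  c * #|` F'|%:R <= #|` induced_edges x F'|%:R -> (#|` F| <= #|` F'|)%N.

(** If [F] splits into two parts without edges between them, then one of the
    parts is at least as good as [F]. *)
Lemma minimal_folner_connected : connected_subgraph (full_sub x F).
Proof.
have [v hv] := fset0Pn _ F0.
apply: (@connected_of_root Cay _ v) => // u hu; apply/joined_sym.
pose C : {fset G} := component (full_sub x F) v.
have inC g : (g \in C) = (g \in F) && `[< joined (full_sub x F) v g >].
  by rewrite /C !inE.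
have vC : v \in C by rewrite inC hv; apply/asboolP/joined_refl.
suff : F = C by move=> E; move: hu; rewrite /= [in X in X -> _]E inC => /andP[_ /asboolP].
apply: contrapT => hFC.
pose D := (F `\` C)%fset.
have CF : (C `<=` F)%fset by apply/fsubsetP => g; rewrite inC => /andP[].
have D0 : D != fset0.
  apply/negP; rewrite fsetD_eq0 => FC; apply: hFC.
  by apply/eqP; rewrite eqEfsubset FC CF.
have card : (#|` C| + #|` D| = #|` F|)%N.
  by rewrite -(cardfsID C F) (fsetIidPr CF).
have C0 : (0 < #|` C|)%N by rewrite cardfs_gt0; apply/fset0Pn; exists v.
have D0' : (0 < #|` D|)%N by rewrite cardfs_gt0.
have split_edges : (induced_edges x F `<=` induced_edges x C `|` induced_edges x D)%fset.
  apply/fsubsetP => -[g j]; rewrite in_fsetU !in_induced_edges /= !in_fsetD.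
  move=> /andP[hg hgx]; rewrite hg hgx !andbT !inC hg hgx /=.
  have hj : joined (full_sub x F) g (g * x j)%g.
    exists [:: ((g, j), true)].
    apply: (@is_path_edge Cay (full_sub x F) ((g, j), true)).
    by rewrite in_induced_edges hg.
  have -> : `[< joined (full_sub x F) v (g * x j)%g >] =
            `[< joined (full_sub x F) v g >].
    apply/asboolP/asboolP => h; first exact: joined_trans h (joined_sym hj).
    exact: joined_trans h hj.
  by case: asboolP.
have hle : (#|` induced_edges x F| <= #|` induced_edges x C| + #|` induced_edges x D|)%N.
  apply: leq_trans (fsubset_leq_card split_edges) _.
  by rewrite cardfsU leq_subr.
have hC : #|` induced_edges x C|%:R < c * #|` C|%:R.
  rewrite ltNge; apply/negP => /Fmin; rewrite -cardfs_gt0 C0 => /(_ isT); lia.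
have hD : #|` induced_edges x D|%:R < c * #|` D|%:R.
  rewrite ltNge; apply/negP => /Fmin; rewrite D0 => /(_ isT); lia.
have : #|` induced_edges x F|%:R <=
    #|` induced_edges x C|%:R + #|` induced_edges x D|%:R :> R.
  by rewrite -natrD ler_nat.
have : #|` F|%:R = #|` C|%:R + #|` D|%:R :> R by rewrite -natrD card.
by move: Fc hC hD => h1 h2 h3 h4; rewrite h4 mulrDr in h1; lra.
Qed.

End MinimalFolner.

(** In an infinite group some edge leaves [F]; otherwise [F] would be closed under
    right multiplication, hence the whole group. *)
Lemma infinite_edge_boundary F : infinite_set [set: G]%classic -> F != fset0 ->
  (#|` induced_edges x F| + 1 <= #|` F| * n)%N.
Proof.
move=> hG /fset0Pn [v hv].
rewrite addn1 -card_outgoing; apply: fproper_ltn_card.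
rewrite fproperEneq; apply/andP; split; last first.
  by apply/fsubsetP => e; rewrite in_induced_edges !inE /= => /andP[->].
apply/eqP => E.
have stable g j : g \in F -> (g * x j)%g \in F.
  move=> hg; have : (g, j) \in (F `*` [fset i in 'I_n])%fset.
    by rewrite in_fsetM hg !inE.
  by rewrite -E in_induced_edges => /andP[].
have stableV g j : g \in F -> (g * (x j)^-1)%g \in F.
  move=> hg; pose f h := (h * x j)%g.
  have hsub : ([fset f h | h in F] `<=` F)%fset.
    by apply/fsubsetP => _ /imfsetP [h /= hh ->]; exact: stable.
  have hF : [fset f h | h in F]%fset = F.
    by apply/eqP; rewrite eqEfcard hsub card_imfset ?leqnn //; exact: mulIg.
  move: hg; rewrite -{1}hF => /imfsetP [h /= hh ->].
  by rewrite /f mulgK.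
apply: hG; apply: (@sub_finite_set _ _ [set` F]%classic) => // h _ /=.
have [w hw] := gen (v^-1 * h)%g.
have -> : h = (v * eval_word x w)%g by rewrite hw mulVKg.
elim/last_ind: w {hw} => [|w l IH]; first by rewrite eval_nil mulg1.
rewrite -cats1 eval_cat eval_cons eval_nil mulg1 mulgA.
by case: l => j [] /=; [exact: stable|exact: stableV].
Qed.

(** In the infinite case [T] is enlarged by a connected almost invariant set
    [F], translated so as to contain the identity.  As some edge leaves [F], its
    cardinality [f] satisfies [1 <= f * d], where [d] is the admitted defect; so
    [T] is negligible with respect to [F] once [d] is small. *)
Lemma folner_extend : folner -> forall (e : R) T, 0 < e ->
  connected_subgraph T -> (1%g : vertex Cay) \in verts T ->
  exists S, [/\ subgraph_le T S, connected_subgraph S &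
                n%:R - 1 + inv_card R G - e <= xi R S].
Proof.
move=> hF e T he hT h1.
have [hG|hG] := pselect (finite_set [set: G]%classic).
  pose F := fset_set [set: G]%classic; have inF g : g \in F by rewrite in_fset_set // inE.
  have cS : connected_subgraph (full_sub x F).
    apply: (@connected_of_root Cay _ (1%g : G)); first exact: inF.
    move=> g _; have [k hk] := wball_cover gen g.
    have [_ hc] := wball_connected x k.
    apply: joined_sub (hc g 1%g hk (wball1 x k)).
    by apply: induced_sub; apply/fsubsetP => h _; exact: inF.
  exists (full_sub x F); split=> //.
    split; apply/fsubsetP => a _; first exact: inF.
    by rewrite in_induced_edges !inF.
  rewrite xi_connected // inv_card_finite // /beta0 /=.
  have -> : induced_edges x F = (F `*` [fset i in 'I_n])%fset.
    by apply/fsetP => a; rewrite in_induced_edges !inE /= !inF.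
  rewrite card_outgoing natrM mulrDl div1r mulrAC divff ?mul1r.
    by rewrite -/F; lra.
  by rewrite pnatr_eq0 -lt0n cardfs_gt0; apply/fset0Pn; exists 1%g.
rewrite inv_card_infinite // addr0.
set t : R := #|` verts T|%:R.
have ht : 0 <= t by [].
have hn : 0 <= n%:R :> R by [].
have hnt : 0 <= n%:R * t by rewrite mulr_ge0.
(* With this defect, [1 <= f * d] implies [n * t + 1 <= f * (e / 2)]. *)
pose d := e / (2 * (n%:R * t + 1)).
have hd : 0 < d by rewrite divr_gt0 //; lra.
have hde : d * (n%:R * t + 1) = e / 2.
  rewrite /d; have : n%:R * t + 1 != 0 by rewrite gt_eqF //; lra.
  by move=> h; rewrite invfM mulrA divfK.
pose P k := `[< exists F, [/\ F != fset0, #|` F| = k &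
  (n%:R - d) * #|` F|%:R <= #|` induced_edges x F|%:R] >].
have exP : exists k, P k.
  by have [F h0 hle] := hF d hd; exists #|` F|; apply/asboolP; exists F.
case: (ex_minnP exP) => k /asboolP [F [F0 <- Fd]] kmin.
have Fmin F' : F' != fset0 ->
    (n%:R - d) * #|` F'|%:R <= #|` induced_edges x F'|%:R -> (#|` F| <= #|` F'|)%N.
  by move=> h0 hle; apply: kmin; apply/asboolP; exists F'.
have [v hv] := fset0Pn _ F0.
pose F1 := ltrans v^-1%g F.
have F1one : 1%g \in F1 by rewrite mem_ltrans invgK mulg1.
have cF1 : connected_subgraph (full_sub x F1).
  apply: (@minimal_folner_connected (n%:R - d)).
  - by apply/fset0Pn; exists 1%g.
  - by rewrite card_ltrans card_induced_ltrans.
  - by move=> F' h0 hle; rewrite card_ltrans; exact: Fmin.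
pose S := sub_union T (full_sub x F1).
have cS : connected_subgraph S.
  exact: (@sub_union_connected _ _ _ _ _ (1%g : G)).
exists S; split=> //; first exact: sub_unionl.
have hV := beta0_gt0 cS.
rewrite xi_connected // -addrA [- 1 - e]addrC addrA lerD2r.
rewrite ler_pdivlMr //.
have hV2 : (beta0 S)%:R <= #|` F|%:R + t :> R.
  rewrite /t -natrD ler_nat /beta0 /S /= -(card_ltrans v^-1%g F).
  by rewrite cardfsU addnC leq_subr.
have hE : #|` induced_edges x F|%:R <= #|` edges S|%:R :> R.
  rewrite ler_nat -(card_induced_ltrans x v^-1%g F); apply: fsubset_leq_card.
  exact: fsubsetUr.
have hb : #|` induced_edges x F|%:R + 1 <= #|` F|%:R * n%:R :> R.
  by rewrite -natrM natr1 ler_nat -addn1; exact: infinite_edge_boundary.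
set f : R := #|` F|%:R in Fd hV2 hb *.
have hf : 1 <= f * d by nra.
have h2 : f * (n%:R * t + 1) * d = f * (e / 2) by rewrite -hde; ring.
have hf0 : 0 <= f by rewrite ler0n.
have h3 : n%:R * t + 1 <= f * (e / 2) by nra.
have h4 : d <= e / 2 by nra.
have [hne|hne] := leP 0 (n%:R - e).
  have h5 : (n%:R - e) * (beta0 S)%:R <= (n%:R - e) * (f + t) by rewrite ler_wpM2l.
  have h6 : f * d <= f * (e / 2) by rewrite ler_wpM2l.
  have : e * t >= 0 by rewrite mulr_ge0 // ltW.
  nra.
have : (n%:R - e) * (beta0 S)%:R <= 0 by rewrite mulr_le0_ge0 // ltW.
have : 0 <= #|` edges S|%:R :> R by [].
lra.
Qed.

Lemma folner_cyclomatic_quotient : folner ->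
  cyclomatic_quotient R x = (n%:R - 1 + inv_card R G)%:E.
Proof.
move=> hF; apply/eqP; rewrite eq_le cyclomatic_quotient_le /=.
have [k T hT h1|S [hS hxi]] := @chain_builder _ _ x gen
    (fun k S => n%:R - 1 + inv_card R G - k.+1%:R^-1 <= xi R S).
  by apply: folner_extend => //; rewrite invr_gt0 ltr0n.
apply: cyclomatic_quotient_lb hS _; apply: limn_esup_lb_eps => e he.
exists (Num.bound e^-1) => i hi; rewrite lee_fin; apply: le_trans (hxi i).
rewrite lerD2l lerN2 invf_ple ?posrE ?ltr0n //.
apply: ltW; apply: lt_le_trans (archi_boundP _) _; first by rewrite invr_ge0 ltW.
by rewrite ler_nat ltnW.
Qed.

End Bounds.

(** * Free generating families *)

Section FreeFamily.
Variables (R : realType) (G : groupType) (n : nat) (x : 'I_n -> G).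
Notation Cay := (cayley_graph x).
Implicit Types (S T : finsubgraph Cay) (w u v : word 'I_n).

(** The family [x] is a basis of the subgroup that it generates. *)
Definition free_family : Prop :=
  forall w, eval_word x w = 1%g -> free_eq w [::].

(** The Cayley graph of a free family is a forest: the label of a closed path
    reduces to the empty word, and the reduction lifts to the path. *)
Lemma free_beta2 S : free_family -> connected_subgraph S -> beta2 S = 0%N.
Proof.
move=> hx hS; have [/fset0Pn [v hv] _] := hS.
apply: (@pi1_rank_unique Cay S v 0 (fun=> [::])) => //; split=> [[]//|q hq|w _].
  have [E hE] := path_cpath hq.
  exists [::]; rewrite E -[subst_word _ _]/(cpath x v [::]).
  apply/cpath_free_eq/hx; apply: (mulgI v).
  by rewrite mulg1 -hE.
by case: w => [|[[]]] //; exact: word_eq_refl.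
Qed.

Lemma cpath_inv (g : G) u :
  cpath x (g * eval_word x u)%g (inv_word u) = inv_word (cpath x g u).
Proof.
elim: u g => [|l u IH] g //.
rewrite inv_word_cons eval_cons cpath_cat eval_inv /= mulgA.
have -> : (if l.2 then x l.1 else (x l.1)^-1)%g = letter_val x l by [].
rewrite mulgK inv_word_cons IH; congr (_ ++ [:: _]).
by case: l => j []; rewrite /edge_at /letter_val /= ?mulgK.
Qed.

Lemma all_inv_word (A : Type) (P : pred A) (w : word A) :
  all (fun l => P l.1) (inv_word w) = all (fun l => P l.1) w.
Proof. by rewrite /inv_word all_rev all_map. Qed.

Lemma cpath_split (g : G) u (e : edge Cay) :
  ~~ all (fun l => l.1 != e) (cpath x g u) ->
  exists u1 l u2, u = u1 ++ l :: u2 /\ (edge_at x (g * eval_word x u1)%g l).1 = e.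
Proof.
elim: u g => [|l u IH] g //=; rewrite negb_and negbK => /orP[/eqP <-|/IH].
  by exists [::], l, u; rewrite eval_nil mulg1.
move=> [u1 [l' [u2 [-> E]]]]; exists (l :: u1), l', u2; split=> //.
by rewrite -E eval_cons mulgA.
Qed.

(** A shortest nontrivial relator [w] traverses its first edge only once:
    otherwise [w] would be equivalent to a product of conjugates of shorter
    relators. *)
Lemma shortest_relator : ~ free_family ->
  exists l u, eval_word x (l :: u) = 1%g /\
    all (fun l' => l'.1 != (edge_at x 1%g l).1) (cpath x (letter_val x l) u).
Proof.
move=> hx.
pose P k := `[< exists w, [/\ size w = k, eval_word x w = 1%g & ~ free_eq w [::]] >].
have exP : exists k, P k.
  apply: contrapT => h; apply: hx => w hw; apply: contrapT => hf.
  by apply: h; exists (size w); apply/asboolP; exists w.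
case: (ex_minnP exP) => k /asboolP [w [<- hw hf]] kmin.
have wmin u : (size u < size w)%N -> eval_word x u = 1%g -> free_eq u [::].
  move=> hu he; apply: contrapT => hn.
  have /kmin : P (size u) by apply/asboolP; exists u.
  by rewrite leqNgt hu.
case: w => [|l u] in hw hf kmin wmin *; first by case: hf; exact: word_eq_refl.
exists l, u; split=> //.
apply: contrapT => /negP /cpath_split [u1 [l' [u2 [E he]]]].
apply: hf; rewrite E in hw wmin *.
have vl m : (if m.2 then x m.1 else (x m.1)^-1)%g = letter_val x m by [].
have sz : (size (l :: u1) < size (l :: u1 ++ l' :: u2))%N.
  by rewrite /= size_cat /=; lia.
(* The first edge is met again in the same direction: both halves of the
   relator are closed.  In the opposite direction, the part between the two
   passages and the part after them are closed. *)
have [hl|hl] := eqVneq l'.2 l.2.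
  have E' : l' = l.
    by move: he hl; clear; case: l => c d; case: l' => a b /= [_ ->] ->.
  have h1 : eval_word x (l :: u1) = 1%g.
    rewrite eval_cons vl; move: he; rewrite E' /edge_at.
    by case: (l.2) => /= -[] //; exact: mulIg.
  rewrite -cat_cons in hw *; rewrite -[[::]](cats0 [::]).
  apply: word_eq_cat; first exact: wmin sz h1.
  apply: wmin; first by rewrite /= size_cat /=; lia.
  by move: hw; rewrite eval_cat h1 mul1g.
have E' : l' = (l.1, ~~ l.2).
  by move: he hl; clear; case: l => c [] ; case: l' => a [] //= [_ ->].
have h1 : eval_word x u1 = 1%g.
  move: he; rewrite E' /edge_at /letter_val /=.
  case: (l.2) => /= -[] h.
    by move: h; rewrite -mulgA => h; apply: (mulgI (x l.1)); apply: (mulIg (x l.1)^-1%g);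
       rewrite -mulgA h mulg1 mulgV.
  by apply: (mulgI (x l.1)^-1%g); rewrite h mul1g mulg1.
have h2 : eval_word x u2 = 1%g.
  move: hw; rewrite -cat_cons eval_cat !eval_cons h1 mulg1 E' /=.
  by case: (l.2) => /=; rewrite mulgA ?mulgV ?mulVg mul1g.
apply: (@word_eq_trans _ _ _ ([:: l] ++ [::] ++ l' :: u2)).
  apply: (@word_eq_catl _ _ [:: l]); apply: word_eq_catr; apply: wmin h1.
  by rewrite /= size_cat /=; lia.
apply: (@word_eq_trans _ _ _ u2); last by apply: wmin h2; rewrite /= size_cat /=; lia.
rewrite E'; case: (l) => a b; exact: (@word_eq_cancel _ _ [::]).
Qed.

(** If [x] is not free, then some edge at the identity lies on a simple cycle:
    its ends are joined by a path that avoids it. *)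
Lemma nonfree_bypass : ~ free_family ->
  exists j u, eval_word x u = x j /\ all (fun l => l.1 != (1%g, j)) (cpath x 1%g u).
Proof.
move=> /shortest_relator [[j []] [u [hu hl]]].
  exists j, (inv_word u).
  have E : (x j * eval_word x u)%g = 1%g by rewrite -hu eval_cons.
  have E' : eval_word x (inv_word u) = x j.
    by rewrite eval_inv; apply: (mulIg (eval_word x u)); rewrite mulVg E.
  split=> //.
  have -> : cpath x 1%g (inv_word u) = inv_word (cpath x (x j) u).
    by rewrite -E cpath_inv.
  exact: (etrans (all_inv_word (fun e : edge Cay => e != (1%g, j)) _) hl).
exists j, u; split.
  by apply: (mulgI (x j)^-1%g); rewrite mulVg -hu eval_cons.
rewrite -(mulgV (x j)) cpath_ltrans all_map.
apply: sub_all hl => -[[a i] b] /=; apply: contraNneq => -[h ->].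
by apply/eqP; congr (_, _); rewrite mul1g; apply: (mulgI (x j)); rewrite h mulgV.
Qed.

Lemma remove_closed S (D : {fset edge Cay}) :
  all (fun e => (source e \in verts S) && (target e \in verts S)) (edges S `\` D)%fset.
Proof.
by apply/allP => e; rewrite in_fsetD => /andP[_ /edge_endsP [-> ->]].
Qed.

Definition remove_edges S D : finsubgraph Cay := FinSubgraph (remove_closed S D).

(** Deleting edges that can be bypassed keeps the subgraph connected, so that
    each of them contributes to the cyclomatic number. *)
Lemma bypass_beta2 S (D : {fset edge Cay}) : connected_subgraph S ->
  (D `<=` edges S)%fset ->
  (forall e, e \in D -> joined (remove_edges S D) (source e) (target e)) ->
  (#|` D| <= beta2 S)%N.
Proof.
move=> hS hD hby.
have hS' : connected_subgraph (remove_edges S D).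
  case: hS => h0 hS; split=> // u v hu hv; have [p hp] := hS u v hu hv.
  elim: p u hu hp => [|l p IH] u hu.
    by rewrite is_path_nil => /andP[/eqP <- _]; exact: joined_refl.
  rewrite is_path_cons => /and3P[he /eqP <- hp].
  apply: joined_trans (IH _ _ hp); last exact: letter_endP he.
  have [hlD|hlD] := boolP (l.1 \in D); last first.
    by exists [:: l]; apply: is_path_edge; rewrite in_fsetD hlD.
  have := hby _ hlD; rewrite /letter_start /letter_end.
  by case: (l.2) => // /joined_sym.
have := beta2_connected hS; have := beta2_connected hS'.
have -> : #|` edges (remove_edges S D)| = (#|` edges S| - #|` D|)%N.
  exact: cardfsDS.
rewrite -[beta0 (remove_edges S D)]/(beta0 S).
have := fsubset_leq_card hD.
move: (beta2 _) (beta2 _) (beta0 _) #|` _| #|` _| => a b c d f; lia.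
Qed.

(** The translates of the bypassed edge by a subset [M] of the ball of radius
    [k] are deleted.  As [M] is separated, the translate of the bypass by an
    element of [M] contains none of the deleted edges. *)
Lemma nonfree_ball_beta2 : ~ free_family ->
  exists L, forall k, exists m, (m <= beta2 (full_sub x (wball x (k + L))))%N /\
    (#|` wball x k| <= m * #|` wball x L|)%N.
Proof.
move=> /nonfree_bypass [j [u [hu hav]]]; exists (size u) => k.
have [M [MK Mc Msep]] :=
  separated_subset (wball x k) (wball1 x (size u)) (@wballV _ _ _ _).
exists #|` M|; split=> //.
pose D : {fset edge Cay} := [fset (g, j) | g in M]%fset.
have inD e : (e \in D) = (e.1 \in M) && (e.2 == j).
  case: e => g i; apply/imfsetP/andP => [[h /= hh [-> ->]]|[/= hg /eqP ->]] //.
  by exists g.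
have <- : #|` D| = #|` M| by rewrite card_imfset // => g h [].
set S := full_sub x _.
have hpath g : g \in M -> all (fun l => l.1 \in edges S) (cpath x g u).
  by move=> hg; apply: cpath_in_induced; apply: (fsubsetP MK).
apply: bypass_beta2; first exact: wball_connected.
  apply/fsubsetP => -[g i]; rewrite inD /= => /andP[hg /eqP ->].
  have hk := fsubsetP MK _ hg.
  rewrite in_induced_edges /= (fsubsetP (wball_sub x (leq_addr (size u) k)) _ hk) /=.
  rewrite wballD mem_fset_mulg //.
  by apply/wballP; exists u.
move=> -[g i]; rewrite inD /= => /andP[hg /eqP ->].
exists (cpath x g u); rewrite -hu; apply: cpath_path.
  have hk := fsubsetP MK _ hg.
  exact: (fsubsetP (wball_sub x (leq_addr (size u) k)) _ hk).
have h0 : all (fun l => l.1 \in induced_edges x (wball x (size u))) (cpath x 1%g u).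
  exact: (@cpath_in_induced _ _ x 0 1%g u (wball1 x 0)).
have := hpath g hg.
rewrite -(mulg1 g) cpath_ltrans !all_map => hS.
apply/allP => -[[a i'] b] hl /=.
have hE : ((g * a)%g, i') \in edges S := allP hS _ hl.
rewrite in_fsetD hE andbT inD /=; apply/negP => /andP[ha /eqP hi].
have := allP h0 _ hl; rewrite in_induced_edges /= => /andP[haL _].
have E : g = (g * a)%g by apply: Msep => //; rewrite mulKg.
have a1 : a = 1%g by apply: (mulgI g); rewrite mulg1 -E.
by have := allP hav _ hl; rewrite /= a1 hi eqxx.
Qed.

Hypothesis gen : forall g, exists w, eval_word x w = g.

Lemma free_cyclomatic_quotient : free_family -> cyclomatic_quotient R x = 0%E.
Proof.
move=> hx; apply/eqP; rewrite eq_le cyclomatic_quotient_ge0 // andbT.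
apply: ge_ereal_sup => _ [S [hc _ _ _] <-].
apply: (@limn_esup_ub _ _ _ 0) => i _.
by rewrite /xi free_beta2 // mul0r.
Qed.

Lemma nonfree_cyclomatic_quotient : ~ free_family -> (0 < cyclomatic_quotient R x)%E.
Proof.
move=> /nonfree_ball_beta2 [L hL].
have hB k : (0 : R) < #|` wball x k|%:R.
  by rewrite ltr0n cardfs_gt0; apply/fset0Pn; exists 1%g; exact: wball1.
pose c : R := (#|` wball x L|%:R * #|` wball x L|%:R)^-1.
apply: (@lt_le_trans _ _ c%:E); first by rewrite lte_fin invr_gt0 mulr_gt0.
apply: (cyclomatic_quotient_lb (wball_chain gen)).
apply: limn_esup_lb => N; exists (N + L)%N; first exact: leq_addr.
have [m [hm hk]] := hL N.
rewrite lee_fin /c /xi ler_pdivlMr; last exact: hB.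
rewrite mulrC ler_pdivrMr ?mulr_gt0 // -!natrM ler_nat.
apply: leq_trans (card_wballD x N L) _; rewrite mulnA leq_mul2r.
apply/orP; right; apply: leq_trans hk _.
by rewrite leq_mul2r hm orbT.
Qed.

End FreeFamily.

(** * Generating families of a free group *)

Lemma eval_wsub (G : groupType) (A B : Type) (z : B -> G) (f : A -> word B) w :
  eval_word z (wsub f w) = eval_word (fun a => eval_word z (f a)) w.
Proof.
elim: w => [|[a b] w IH]; first by rewrite !eval_nil.
rewrite wsub_cons eval_cat IH eval_cons /=.
by case: b; rewrite ?eval_inv.
Qed.

(** A finite partial injection, given by its graph, extends to a permutation. *)
Lemma extend_perm (T : finType) (L : seq (T * T)) :
  {in L &, forall c d, (c.1 == d.1) = (c.2 == d.2)} ->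
  exists s : {perm T}, forall c, c \in L -> s c.1 = c.2.
Proof.
elim: L => [|c L IH] hL; first by exists 1%g.
have [|s hs] := IH; first by move=> d d' hd hd'; apply: hL; rewrite in_cons ?hd ?hd' orbT.
exists (s * tperm (s c.1) c.2)%g => d; rewrite in_cons => /orP[/eqP ->|hd].
  by rewrite permM tpermL.
have := hL c d; rewrite !in_cons eqxx hd orbT => /(_ isT isT) E.
rewrite permM; have [E1|E1] := eqVneq c.1 d.1.
  by move: E; rewrite E1 eqxx => /esym/eqP ->; rewrite hs // tpermR.
rewrite (hs d hd) tpermD -?E // -(hs d hd).
by apply: contraNneq E1 => /perm_inj ->.
Qed.

(** Free groups are residually finite: a reduced word [w] of length [m] is
    realized by permutations of [m + 1] points that move the first point step
    by step to the last one. *)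
Lemma residually_finite n (w : word 'I_n) : ~ free_eq w [::] ->
  exists m, exists q : 'I_n -> {perm 'I_m.+1}, eval_word q w <> 1%g.
Proof.
move=> hw.
pose P k := `[< exists v, size v = k /\ free_eq w v >].
have exP : exists k, P k.
  by exists (size w); apply/asboolP; exists w; split=> //; exact: word_eq_refl.
case: (ex_minnP exP) => m /asboolP [v [vm hv]] kmin.
have m0 : (0 < m)%N.
  by rewrite lt0n; apply/eqP => m0; apply: hw; move: hv; rewrite (size0nil (etrans vm m0)).
have [l0 _] : exists l0 : 'I_n * bool, True.
  by case: v vm {hv} => [|l v] E; [move: m0; rewrite -E | exists l].
have red i : (i.+1 < m)%N -> (nth l0 v i).1 = (nth l0 v i.+1).1 ->
    (nth l0 v i).2 = (nth l0 v i.+1).2.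
  move=> hi h1; apply/eqP/negPn/negP => h2.
  have hD : drop i v = nth l0 v i :: nth l0 v i.+1 :: drop i.+2 v.
    by rewrite -!drop_nth ?vm // ltnW.
  have Ev : v = take i v ++ [:: nth l0 v i; nth l0 v i.+1] ++ drop i.+2 v.
    by rewrite -{1}(cat_take_drop i v) hD.
  have hred : free_eq v (take i v ++ drop i.+2 v).
    rewrite {1}Ev; move: h1 h2; case: (nth l0 v i) => a b; case: (nth l0 v i.+1) => c d /=.
    move=> <- hbd; have -> : d = ~~ b by case: b d hbd => [] [].
    exact: word_eq_cancel.
  have /kmin : P (size (take i v ++ drop i.+2 v)).
    by apply/asboolP; eexists; split; [reflexivity | exact: word_eq_trans hv hred].
  by rewrite size_cat size_take size_drop vm; case: ltnP; lia.
(* The letter at position [i] should move the point [i] to [i + 1]. *)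
pose c (i : 'I_m) : 'I_m.+1 * 'I_m.+1 :=
  if (nth l0 v i).2 then (inord i, inord i.+1) else (inord i.+1, inord i).
have hq a : exists s : {perm 'I_m.+1},
    forall i : 'I_m, (nth l0 v i).1 = a -> s (c i).1 = (c i).2.
  have [|s hs] := @extend_perm _
    [seq c i | i <- [seq i <- enum 'I_m | (nth l0 v (nat_of_ord i)).1 == a]].
    move=> _ _ /mapP [i + ->] /mapP [j + ->]; rewrite !mem_filter.
    move=> /andP[/eqP hi _] /andP[/eqP hj _].
    have E (k k' : nat) : (k < m.+1)%N -> (k' < m.+1)%N ->
        (inord k == inord k' :> 'I_m.+1) = (k == k').
      by move=> h h'; rewrite -val_eqE /= !inordK.
    have hi' := ltn_ord i; have hj' := ltn_ord j.
    rewrite /c; case bi: (nth l0 v i).2; case bj: (nth l0 v j).2 => /=;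
      rewrite !E ?ltnS ?eqSS // 1?ltnW //.
      have [ij|ij] := eqVneq (i : nat) j.+1.
        by have := red j; rewrite -ij hi hj bi bj => /(_ hi' erefl).
      have [ij'|//] := eqVneq i.+1 (j : nat).
      by have := red i; rewrite ij' hi hj bi bj => /(_ hj' erefl).
    have [ij|ij] := eqVneq i.+1 (j : nat).
      by have := red i; rewrite ij hi hj bi bj => /(_ hj' erefl).
    have [ij'|//] := eqVneq (i : nat) j.+1.
    by have := red j; rewrite -ij' hi hj bi bj => /(_ hi' erefl).
  exists s => i hi; apply: hs; apply/mapP; exists i => //.
  by rewrite mem_filter hi eqxx mem_enum.
have /choice [q hq'] := hq.
exists m, q => h1.
have main i : (i <= m)%N -> eval_word q (take i v) ord0 = inord i.
  elim: i => [|i IH] hi.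
    by rewrite take0 eval_nil perm1; apply/val_inj; rewrite /= inordK.
  rewrite (take_nth l0) ?vm // -cats1.
  rewrite eval_cat.
  rewrite eval_cons.
  rewrite eval_nil.
  rewrite [X in (_ * X)%g]mulg1.
  rewrite permM.
  rewrite IH; last exact: ltnW.
  have := hq' (nth l0 v i).1 (Ordinal hi) erefl; rewrite /c /=.
  by case: (nth l0 v i).2 => //= <-; rewrite permK.
have := main m (leqnn m); rewrite take_oversize ?vm //.
rewrite -(eval_free_eq q hv) h1 perm1 => /(congr1 val) /=.
by rewrite inordK // => E; move: m0; rewrite -E.
Qed.

(** The Hopfian property: [n] generators of a free group of rank [n] are free.
    For every finite group [Q], a homomorphism to [Q] is determined by its
    values on [x] as well as by its values on the basis [y], so that by counting
    all [n]-tuples of elements of [Q] occur as values on [x]. *)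
Lemma free_of_rank_free_family (G : groupType) n (x : 'I_n -> G) :
  (forall g, exists w, eval_word x w = g) -> free_of_rank G n -> free_family x.
Proof.
move=> gen [y [ygen yrel]] w hw; apply: contrapT => /residually_finite [m [q hq]].
have yeq u v : eval_word y u = eval_word y v -> free_eq u v.
  by move=> E; apply/word_eq_mulV/yrel; rewrite eval_cat eval_inv E mulgV.
have /choice [W hW] : forall j, exists u, eval_word y u = x j by move=> j; exact: ygen.
have /choice [V hV] : forall i, exists u, eval_word x u = y i by move=> i; exact: gen.
have xW u : eval_word y (wsub W u) = eval_word x u.
  by rewrite eval_wsub; congr eval_word; apply/funext.
pose Psi (z : {ffun 'I_n -> {perm 'I_m.+1}}) : {ffun 'I_n -> {perm 'I_m.+1}} :=
  [ffun j => eval_word z (W j)].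
have Psi_inj : injective Psi.
  suff h (z : {ffun 'I_n -> {perm 'I_m.+1}}) i : z i = eval_word (Psi z) (V i).
    by move=> z z' E; apply/ffunP => i; rewrite !h E.
  have -> : eval_word (Psi z) (V i) = eval_word z (wsub W (V i)).
    by rewrite eval_wsub; congr eval_word; apply/funext => j; rewrite ffunE.
  rewrite (@eval_free_eq _ _ z _ [:: (i, true)]).
    by rewrite eval_cons eval_nil mulg1.
  by apply: yeq; rewrite xW hV eval_cons eval_nil mulg1.
have [inv _ Psi_K] := injF_bij Psi_inj.
apply: hq; pose z := inv [ffun j => q j].
have -> : eval_word q w = eval_word z (wsub W w).
  rewrite eval_wsub; congr eval_word; apply/funext => j.
  by have := Psi_K [ffun j => q j] => /ffunP /(_ j); rewrite !ffunE.
rewrite (@eval_free_eq _ _ z _ [::]) ?eval_nil //.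
by apply: yeq; rewrite xW hw eval_nil.
Qed.

(** * The marriage theorem for an infinite family of finite sets *)

Section Marriage.
Variables (I T : choiceType).
Implicit Types (A B : I -> {fset T}) (J K : {fset I}).

Definition union_over B J : {fset T} := (\bigcup_(i <- enum_fset J) B i)%fset.

Lemma union_overP B J t :
  reflect (exists2 i, i \in J & t \in B i) (t \in union_over B J).
Proof.
rewrite /union_over; apply: (iffP (bigfcupP _ _ _ _));
  move=> [i hi ht]; exists i => //; first by case/andP: hi.
by rewrite andbT.
Qed.

(** The condition of Hall on finite subfamilies. *)
Definition hall B : Prop := forall J, (#|` J| <= #|` union_over B J|)%N.

(* The families of subsets of the [A i] that still satisfy the condition; they
   are ordered by reverse inclusion in the application of the lemma of Zorn. *)
Let refinement A := {B | hall B /\ forall i, (B i `<=` A i)%fset}.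

(** Along a chain of refinements each finite set stabilizes, and finitely many
    of them do so simultaneously; hence the intersection is a refinement. *)
Lemma hall_chain A (C : set (refinement A)) :
  hall A ->
  total_on C (fun s t => `[< forall i, (sval t i `<=` sval s i)%fset >]) ->
  exists t : refinement A, forall s, C s ->
    `[< forall i, (sval t i `<=` sval s i)%fset >].
Proof.
move=> hA hC.
have [[s0 hs0]|C0] := pselect (exists s, C s); last first.
  have hAA : hall A /\ forall i, (A i `<=` A i)%fset by split.
  by exists (exist _ A hAA) => s hs; case: C0; exists s.
have /choice [b hb] : forall i, exists s, C s /\
    forall s', C s' -> (sval s i `<=` sval s' i)%fset.
  move=> i; pose P k := `[< exists s, C s /\ #|` sval s i| = k >].
  have exP : exists k, P k by exists #|` sval s0 i|; apply/asboolP; exists s0.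
  case: (ex_minnP exP) => k /asboolP [s [hs sk]] kmin.
  exists s; split=> // s' hs'; have [/asboolP h|/asboolP h] := hC _ _ hs hs'; last exact: h.
  have /kmin hle : P #|` sval s' i| by apply/asboolP; exists s'.
  suff -> : sval s' i = sval s i by [].
  by apply/eqP; rewrite eqEfcard h sk.
pose B i := sval (b i) i.
have hB : hall B.
  move=> J; suff [s hs hsJ] : exists2 s, C s & forall i, i \in J -> (sval s i `<=` B i)%fset.
    apply: leq_trans ((svalP s).1 J) _; apply: fsubset_leq_card.
    apply/fsubsetP => t /union_overP [i hi ht]; apply/union_overP.
    by exists i => //; exact: (fsubsetP (hsJ i hi)).
  elim/finSet_rect: J => J IH.
  have [->|/fset0Pn [i hi]] := eqVneq J fset0; first by exists s0.
  have [|s hs hsJ] := IH (J `\ i)%fset; first by rewrite fproperD1.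
  have [hbi1 hbi2] := hb i.
  have [/asboolP h|/asboolP h] := hC _ _ hs hbi1.
    exists (b i) => // j hj; have [->|ji] := eqVneq j i; first exact: fsubset_refl.
    by apply: fsubset_trans (h j) (hsJ _ _); rewrite in_fsetD1 ji.
  exists s => // j hj; have [->|ji] := eqVneq j i; first exact: h.
  by apply: hsJ; rewrite in_fsetD1 ji.
have hBA : hall B /\ forall i, (B i `<=` A i)%fset.
  by split=> // i; exact: (svalP (b i)).2.
exists (exist _ B hBA) => s hs; apply/asboolP => i /=.
exact: (hb i).2.
Qed.

(** Rado's argument: in a minimal family that satisfies the condition of Hall
    every set is a singleton. *)
Lemma hall_minimal_singleton B i s t : hall B ->
  (forall B', hall B' -> (forall j, (B' j `<=` B j)%fset) ->
     forall j, (B j `<=` B' j)%fset) ->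
  s \in B i -> t \in B i -> s = t.
Proof.
move=> hB Bmin hs ht; apply/eqP/negPn/negP => st.
have drop u : u \in B i -> exists J, i \notin J /\
    (#|` union_over B J `|` (B i `\ u)| <= #|` J|)%fset%N.
  move=> hu; pose B' j := if j == i then (B i `\ u)%fset else B j.
  have B'B j : (B' j `<=` B j)%fset.
    by rewrite /B'; case: eqP => [->|_]; [exact: fsubD1set|exact: fsubset_refl].
  have nB' : ~ hall B'.
    move=> /Bmin /(_ B'B) /(_ i) /fsubsetP /(_ u hu).
    by rewrite /B' eqxx !inE eqxx.
  have [J hJ] : exists J, (#|` union_over B' J| < #|` J|)%N.
    apply: contrapT => h; apply: nB' => J; rewrite leqNgt; apply/negP => hJ.
    by apply: h; exists J.
  have iJ : i \in J.
    apply/negPn/negP => iJ; have := hB J; rewrite leqNgt => /negP; apply.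
    apply: leq_ltn_trans hJ; apply: fsubset_leq_card; apply/fsubsetP => v.
    move=> /union_overP [j hj hv]; apply/union_overP; exists j => //.
    by rewrite /B'; case: eqP => // E; rewrite -E hj in iJ.
  exists (J `\ i)%fset; split; first by rewrite in_fsetD1 eqxx.
  rewrite (cardfsD1 i J) iJ add1n ltnS in hJ; apply: leq_trans hJ.
  apply: fsubset_leq_card; apply/fsubsetP => v; rewrite in_fsetU => /orP[|hv].
    move=> /union_overP [j]; rewrite in_fsetD1 => /andP[ji hj] hv.
    by apply/union_overP; exists j => //; rewrite /B' (negPf ji).
  by apply/union_overP; exists i => //; rewrite /B' eqxx.
have [J [iJ hJ]] := drop s hs; have [K [iK hK]] := drop t ht.
move: hJ hK; set P := (_ `|` _)%fset; set Q := (_ `|` _)%fset => hJ hK.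
have inP v : (v \in P) = (v \in union_over B J) || (v != s) && (v \in B i).
  by rewrite in_fsetU in_fsetD1.
have inQ v : (v \in Q) = (v \in union_over B K) || (v != t) && (v \in B i).
  by rewrite in_fsetU in_fsetD1.
have h1 : (#|` (i |` (J `|` K))%fset| <= #|` (P `|` Q)%fset|)%N.
  apply: leq_trans (hB _) _; apply: fsubset_leq_card; apply/fsubsetP => v.
  move=> /union_overP [j hj].
  have {hj} : [|| j == i, j \in J | j \in K] by move: hj; rewrite !in_fsetU in_fset1.
  move=> /or3P [/eqP ->|hj|hj] hv.
  - rewrite in_fsetU inP inQ hv !andbT.
    have [->|_] := eqVneq v s; last by rewrite !orbT.
    by rewrite st !orbT.
  - rewrite in_fsetU inP; apply/orP; left; apply/orP; left.
    by apply/union_overP; exists j.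
  - rewrite in_fsetU inQ; apply/orP; right; apply/orP; left.
    by apply/union_overP; exists j.
have h2 : (#|` (J `&` K)%fset| <= #|` (P `&` Q)%fset|)%N.
  apply: leq_trans (hB _) _; apply: fsubset_leq_card; apply/fsubsetP => v.
  move=> /union_overP [j]; rewrite in_fsetI => /andP[hjJ hjK] hv.
  rewrite in_fsetI inP inQ; apply/andP; split; apply/orP; left;
    by apply/union_overP; exists j.
rewrite cardfsU1 in_fsetU negb_or iJ iK in h1.
have := cardfsUI P Q; have := cardfsUI J K.
by move: hJ hK h1 h2 => /=; rewrite ?add1n; lia.
Qed.

Lemma marriage A : hall A ->
  exists f : I -> T, injective f /\ forall i, f i \in A i.
Proof.
move=> hA.
have hAA : hall A /\ forall i, (A i `<=` A i)%fset by split.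
have [||C hC|[B [hB BA]] Bmax] := @ZL_preorder (refinement A) (exist _ A hAA)
  (fun s t => `[< forall i, (sval t i `<=` sval s i)%fset >]).
- by move=> s; apply/asboolP.
- move=> r s t /asboolP h1 /asboolP h2; apply/asboolP => i.
  exact: fsubset_trans (h2 i) (h1 i).
- by have [t ht] := hall_chain hA hC; exists t.
have Bsing i s t : s \in B i -> t \in B i -> s = t.
  apply: hall_minimal_singleton => // B' hB' B'B.
  have h : hall B' /\ forall i, (B' i `<=` A i)%fset.
    by split=> // j; exact: fsubset_trans (B'B j) (BA j).
  by have /asboolP := Bmax (exist _ B' h) (asboolT B'B).
have /choice [f hf] : forall i, exists t, t \in B i.
  move=> i; have := hB [fset i]%fset; rewrite cardfs1 cardfs_gt0 => /fset0Pn [t].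
  by move=> /union_overP [j]; rewrite in_fset1 => /eqP -> ht; exists t.
exists f; split=> [i j fij|i]; last exact: (fsubsetP (BA i)).
apply/eqP/negPn/negP => ij; have := hB [fset i; j]%fset.
rewrite cardfs2 ij leqNgt => /negP; apply.
suff /fsubset_leq_card : (union_over B [fset i; j] `<=` [fset f i])%fset by rewrite cardfs1.
apply/fsubsetP => t /union_overP [k]; rewrite in_fset2 in_fset1.
by move=> /orP[] /eqP -> ht; apply/eqP; [exact: Bsing (hf i)|rewrite fij; exact: Bsing (hf j)].
Qed.

End Marriage.

(** * Amenability and near-invariant finite sets *)

Section InvariantMeasure.
Variables (R : realType) (G : groupType) (mu : set G -> R).
Hypothesis mu_ge0 : forall A, 0 <= mu A.
Hypothesis muT : mu setT = 1.
Hypothesis muU : forall A B, (A `&` B = set0 -> mu (A `|` B) = mu A + mu B)%classic.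
Hypothesis mu_inv : forall g A, mu [set (g * a)%g | a in A]%classic = mu A.

Lemma mu_le1 A : mu A <= 1.
Proof.
rewrite -muT -(setUv A) muU ?setICr //.
by rewrite lerDl.
Qed.

Lemma mu_set0 : mu set0 = 0.
Proof.
have := muU (setI0 set0); rewrite setU0 => /eqP.
by rewrite -subr_eq0 opprD addNKr oppr_eq0 => /eqP.
Qed.

(** Finite additivity over a finite disjoint family. *)
Lemma mu_sum (J : eqType) (s : seq J) (A : J -> set G) :
  uniq s -> (forall i j g, A i g -> A j g -> i = j) ->
  mu [set g | exists2 i, i \in s & A i g]%classic = \sum_(i <- s) mu (A i).
Proof.
move=> + hA; elim: s => [_|i s IH /= /andP[his hs]].
  rewrite big_nil -mu_set0; congr mu; apply/seteqP; split=> // g [//].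
rewrite big_cons -IH // -muU.
  congr mu; apply/seteqP; split=> g.
    move=> [j]; rewrite in_cons => /orP[/eqP ->|hj] hg; first by left.
    by right; exists j.
  move=> [hg|[j hj hg]]; first by exists i => //; exact: mem_head.
  by exists j => //; rewrite in_cons hj orbT.
apply/seteqP; split=> // g [hg [j hj hg']].
by move: his; rewrite (hA _ _ _ hg hg') hj.
Qed.

(** The range of a piecewise translation has full measure. *)
Lemma mu_piecewise (K : {fset G}) (f : G -> G) : injective f ->
  (forall g, (f g * g^-1)%g \in K) -> mu (range f) = 1.
Proof.
move=> finj hf.
pose P k := [set g | f g = (k * g)%g]%classic.
have Pdisj k l g : P k g -> P l g -> k = l.
  by rewrite /P /= => -> /mulIg.
have -> : range f = [set h | exists2 k, k \in enum_fset K &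
    [set (k * a)%g | a in P k]%classic h]%classic.
  apply/seteqP; split=> h /=.
    move=> [g _ <-]; exists (f g * g^-1)%g; first exact: hf.
    by exists g; rewrite /P /= mulgVK.
  by move=> [k _ [g hg <-]]; exists g.
rewrite mu_sum ?fset_uniq //; last first.
  move=> k l h [g hg <-] [g' hg']; rewrite -hg -hg' => /finj E.
  by move: hg'; rewrite E => hg'; exact: Pdisj hg hg'.
under eq_bigr do rewrite mu_inv.
rewrite -mu_sum ?fset_uniq // -muT; congr mu.
apply/seteqP; split=> // g _ /=; exists (f g * g^-1)%g; first exact: hf.
by rewrite /P /= mulgVK.
Qed.

End InvariantMeasure.

Section Amenable.
Variables (R : realType) (G : groupType) (n : nat) (x : 'I_n -> G).
Implicit Types (F : {fset G}).

(** Edges leaving [F] end in the outer boundary of [F], and at most [n] of them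
    end at the same vertex. *)
Lemma boundary_edges F :
  (#|` F| * n + #|` F| * n <=
   #|` induced_edges x F| + #|` fset_mulg F (1%g |` letters x)%fset| * n)%N.
Proof.
set N := fset_mulg _ _; pose O := ((F `*` [fset i in 'I_n]) `\` induced_edges x F)%fset.
have FN : (F `<=` N)%fset.
  by apply/fsubsetP => g hg; rewrite -[g]mulg1 mem_fset_mulg // in_fset1U eqxx.
have hE : (#|` O| + #|` induced_edges x F| = #|` F| * n)%N.
  have EF : (induced_edges x F `<=` F `*` [fset i in 'I_n])%fset.
    by apply/fsubsetP => e; rewrite in_induced_edges !inE /= => /andP[->].
  by rewrite /O (cardfsDS EF) subnK ?card_outgoing // -(card_outgoing n F) fsubset_leq_card.
have hO : (#|` O| <= #|` (N `\` F)%fset| * n)%N.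
  rewrite -(card_outgoing n (N `\` F)%fset).
  pose phi (e : G * 'I_n) := ((e.1 * x e.2)%g, e.2).
  have phi_inj : injective phi.
    by move=> [a b] [c d] /= [E bd]; move: E; rewrite bd => /mulIg ->.
  have <- : #|` [fset phi e | e in O]%fset| = #|` O| by rewrite card_imfset.
  apply: fsubset_leq_card.
  apply/fsubsetP => _ /imfsetP [[g j] /= hg ->].
  move: hg; rewrite in_fsetD in_induced_edges in_fsetM => /andP[/= + /andP[hg _]].
  rewrite hg /= => hgx; rewrite in_fsetM in_fsetD /= hgx !inE /= andbT.
  apply: mem_fset_mulg => //; rewrite in_fset1U; apply/orP; right.
  by apply/letterP; exists (j, true).
have := cardfsDS FN; have := fsubset_leq_card FN => hle hD.
rewrite hD mulnBl in hO; have : (#|` F| * n <= #|` N| * n)%N by rewrite leq_mul2r hle orbT.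
lia.
Qed.

(** A uniform lower bound on the boundary makes the sets [F * wball k] grow
    exponentially in [k], uniformly in [F]. *)
Lemma not_folner_growth : ~ folner R x ->
  exists k, forall F, (2 * #|` F| <= #|` fset_mulg F (wball x k)|)%N.
Proof.
move=> hF.
have [e he hE] : exists2 e : R, 0 < e & forall F, F != fset0 ->
    #|` induced_edges x F|%:R < (n%:R - e) * #|` F|%:R.
  apply: contrapT => h; apply: hF => e he; apply: contrapT => h'; apply: h.
  exists e => // F h0; rewrite ltNge; apply/negP => hle.
  by apply: h'; exists F.
have Fpos F : F != fset0 -> (0 : R) < #|` F|%:R by rewrite ltr0n cardfs_gt0.
have n0 : (0 : R) < n%:R.
  have h0 : [fset (1%g : G)]%fset != fset0 by apply/fset0Pn; exists 1%g; rewrite in_fset1.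
  have h1 := hE _ h0; have h2 := Fpos _ h0.
  have : (0 : R) <= #|` induced_edges x [fset (1%g : G)]%fset|%:R by [].
  move: (#|` _|%:R : R) h1 h2 => a h1 h2 h3; nra.
pose d := e / n%:R; have hd : 0 < d by rewrite divr_gt0.
have step F : (1 + d) * #|` F|%:R <= #|` fset_mulg F (1%g |` letters x)%fset|%:R.
  have [->|F0] := eqVneq F fset0; first by rewrite cardfs0 mulr0.
  have := boundary_edges F; rewrite -(ler_nat R) !natrD !natrM => hb.
  have h1 := hE F F0.
  rewrite -(ler_pM2r n0); have -> : (1 + d) * #|` F|%:R * n%:R = #|` F|%:R * (n%:R + e).
    by rewrite mulrC mulrA mulrC mulrDr mulr1 /d mulrCA divff ?mulr1 // gt_eqF.
  move: (#|` F|%:R : R) (#|` _|%:R : R) (#|` _|%:R : R) hb h1 => a b c; nra.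
have growth k F : (1 + d) ^+ k * #|` F|%:R <= #|` fset_mulg F (wball x k)|%:R.
  elim: k => [|k IH]; first by rewrite expr0 mul1r fset_mulg1.
  rewrite wballS fset_mulgA; apply: le_trans (step _).
  by rewrite exprS -mulrA ler_pM2l // addr_gt0.
have bern k : 1 + k%:R * d <= (1 + d) ^+ k.
  elim: k => [|k IH]; first by rewrite mul0r addr0 expr0.
  rewrite exprS -natr1; have : 0 <= k%:R :> R by [].
  move: (k%:R : R) ((1 + d) ^+ k) IH => a b; nra.
exists (Num.bound d^-1) => F; rewrite -(ler_nat R) natrM.
apply: le_trans (growth _ F); apply: ler_wpM2r; first by [].
apply: le_trans (bern _); have := archi_boundP (ltW (_ : 0 < d^-1)).
rewrite invr_gt0 => /(_ hd); rewrite -(ltr_pM2r hd) mulVf ?gt_eqF //.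
lra.
Qed.

(** Without near-invariant sets, the marriage theorem produces a paradoxical
    decomposition. *)
Lemma amenable_folner : amenable R G -> folner R x.
Proof.
move=> [mu [mu_ge0 muT muU mu_inv]]; apply: contrapT => /not_folner_growth [k hk].
pose K := wball x k.
pose A (p : G * bool) := ltrans p.1 K.
have hA : hall A.
  move=> J; pose F := [fset p.1 | p in J]%fset.
  have h1 : (#|` J| <= #|` F| * 2)%N.
    have <- : #|` [fset true; false]%fset| = 2%N by rewrite cardfs2.
    rewrite -cardfsM; apply: fsubset_leq_card; apply/fsubsetP => p hp.
    rewrite in_fsetM; apply/andP; split; last by rewrite !inE; case: (p.2).
    by apply/imfsetP; exists p.
  apply: leq_trans h1 _; rewrite mulnC; apply: leq_trans (hk F) _.
  apply: fsubset_leq_card; apply/fsubsetP => _ /fset_mulgP [_ [h [/imfsetP [p /= hp ->] hh ->]]].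
  by apply/union_overP; exists p => //; rewrite mem_ltrans mulKg.
have [f [finj hf]] := marriage hA.
(* [f] moves points by right multiplication, while the measure is invariant
   under left multiplication. *)
pose r b g := ((f (g^-1, b))^-1)%g.
have rinj b : injective (r b) by move=> g h /invg_inj /finj [/invg_inj].
have rK b g : (r b g * g^-1)%g \in K.
  have := hf (g^-1%g, b); rewrite mem_ltrans /= invgK => /wballV.
  by rewrite invgM.
have full b : mu (range (r b)) = 1 by exact: mu_piecewise (rinj b) (rK b).
have disj : (range (r true) `&` range (r false))%classic = set0.
  apply/seteqP; split=> // _ [[g _ <-] [h _ /invg_inj /finj]].
  by [].
have := mu_le1 mu_ge0 muT muU (range (r true) `|` range (r false))%classic.
rewrite muU // !full; lra.
Qed.

End Amenable.

Section FolnerAmenable.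
Variables (R : realType) (G : groupType) (n : nat) (x : 'I_n -> G).
Implicit Types (F : {fset G}) (A B : set G).
Hypothesis gen : forall g, exists w, eval_word x w = g.

(** The proportion of the inverses of the elements of [F] that lie in [A];
    the inversion turns right translations into left ones. *)
Definition density F A : R :=
  #|` [fset h in F | `[< A (h^-1)%g >]]%fset|%:R / #|` F|%:R.

Lemma density_ge0 F A : 0 <= density F A.
Proof. by rewrite divr_ge0. Qed.

Lemma density_le1 F A : density F A <= 1.
Proof.
have [->|F0] := eqVneq F fset0.
  by rewrite /density cardfs0 invr0 mulr0.
rewrite ler_pdivrMr ?ltr0n ?cardfs_gt0 // mul1r ler_nat.
by apply: fsubset_leq_card; apply/fsubsetP => h; rewrite !inE => /andP[].
Qed.

Lemma densityT F : F != fset0 -> density F setT = 1.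
Proof.
move=> F0; rewrite /density.
have -> : [fset h in F | `[< [set: G]%classic (h^-1)%g >]]%fset = F.
  by apply/fsetP => h; rewrite !inE /= asboolT // andbT.
by rewrite divff // pnatr_eq0 -lt0n cardfs_gt0.
Qed.

Lemma densityU F A B : (A `&` B = set0)%classic ->
  density F (A `|` B)%classic = density F A + density F B.
Proof.
move=> AB; rewrite /density -mulrDl -natrD; congr (_%:R / _).
set P := [fset h in F | `[< A (h^-1)%g >]]%fset.
set Q := [fset h in F | `[< B (h^-1)%g >]]%fset.
have PQ0 : (P `&` Q = fset0)%fset.
  apply/fsetP => h; rewrite !inE; apply/negP.
  move=> /andP[/andP[_ /asboolP hA] /andP[_ /asboolP hB]].
  by have : (set0 : set G) (h^-1)%g by rewrite -AB.
rewrite -cardfsUI PQ0 cardfs0 addn0; congr (size (enum_fset _)).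
by apply/fsetP => h; rewrite !inE /= -andb_orr -asbool_or.
Qed.

Lemma density_translate F j A (e : R) : F != fset0 ->
  (n%:R - e) * #|` F|%:R <= #|` induced_edges x F|%:R ->
  density F [set (x j * a)%g | a in A]%classic <= density F A + e.
Proof.
move=> F0 hF.
have Fpos : (0 : R) < #|` F|%:R by rewrite ltr0n cardfs_gt0.
(* The elements of [F] that right multiplication by [x j] moves out of [F]. *)
pose D := [fset h in F | (h * x j)%g \notin F]%fset.
have hD : (#|` D| + #|` induced_edges x F| <= #|` F| * n)%N.
  have inDj : injective (fun h : G => (h, j)) by move=> h h' [].
  have <- : #|` [fset (h, j) | h in D]%fset| = #|` D| by rewrite card_imfset.
  have disj : ([fset (h, j) | h in D] `&` induced_edges x F = fset0)%fset.
    apply/fsetP => e0; rewrite in_fsetI in_fset0; apply/negP => /andP[].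
    move=> /imfsetP [h /= + ->]; rewrite in_induced_edges !inE /= => /andP[_ hn].
    by rewrite (negPf hn) andbF.
  have := cardfsUI [fset (h, j) | h in D]%fset (induced_edges x F).
  rewrite disj cardfs0 addn0 => <-; rewrite -card_outgoing; apply: fsubset_leq_card.
  rewrite fsubUset; apply/andP; split; apply/fsubsetP => a.
    by move=> /imfsetP [h /= + ->]; rewrite !inE /= => /andP[->].
  by rewrite in_induced_edges !inE /= => /andP[->].
pose E := [fset h in F | `[< A (h^-1)%g >]]%fset.
have hE : (#|` [fset h in F | `[< [set (x j * a)%g | a in A]%classic (h^-1)%g >]]%fset|
    <= #|` D| + #|` E|)%N.
  have <- : #|` [fset (h * (x j)^-1)%g | h in E]%fset| = #|` E|.
    by rewrite card_imfset //; exact: mulIg.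
  have le2 : (#|` (D `|` [fset (h * (x j)^-1)%g | h in E])%fset| <=
      #|` D| + #|` [fset (h * (x j)^-1)%g | h in E]%fset|)%N.
    by rewrite cardfsU leq_subr.
  apply: leq_trans le2; apply: fsubset_leq_card; apply/fsubsetP => h.
  rewrite !inE /= => /andP[hF' /asboolP [a hA ha]].
  rewrite hF' /=; case: (boolP (_ \in F)) => //= hx.
  apply/imfsetP; exists (h * x j)%g; last by rewrite mulgK.
  rewrite !inE /= hx; apply/asboolP.
  by rewrite invgM -ha mulKg.
rewrite /density -/E -[e](@mulfK _ #|` F|%:R) ?gt_eqF // -mulrDl.
rewrite ler_pM2r ?invr_gt0 //.
move: hE hD; rewrite -!(ler_nat R) natrD => hE; rewrite natrD natrM => hD.
by apply: le_trans hE _; move: hF; rewrite mulrBl; lra.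
Qed.

(** Sequences in the unit interval converge along an ultrafilter. *)
Lemma ultra_limit (U : set_system nat) (u : nat -> R) : UltraFilter U ->
  (forall i, 0 <= u i <= 1) -> exists l : R, (u @ U --> l)%classic.
Proof.
move=> UU hu.
have [l [_ hl]] : (`[0, 1] `&` cluster (u @ U) !=set0)%classic.
  apply: (@segment_compact R 0 1).
  have h : U (u @^-1` `[0, 1])%classic.
    by apply: filterE => i; rewrite /= in_itv /=; exact: hu.
  exact: h.
exists l => N hN.
have [//|hC] := in_ultra_setVsetC (u @^-1` N)%classic UU.
by have [z [hz1 hz2]] := hl (~` N)%classic N hC hN.
Qed.

(** A limit along an ultrafilter of the densities in near-invariant sets is an
    invariant measure. *)
Lemma folner_amenable : folner R x -> amenable R G.
Proof.
move=> hF.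
have /choice [F hFi] : forall i : nat, exists F, F != fset0 /\
    (n%:R - i.+1%:R^-1) * #|` F|%:R <= #|` induced_edges x F|%:R :> R.
  move=> i; have [|F F0 hle] := hF i.+1%:R^-1; first by rewrite invr_gt0 ltr0n.
  by exists F.
have [U [UU UF]] := ultraFilterLemma eventually_filter.
pose u A i := density (F i) A.
have /choice [mu hmu] : forall A, exists l : R, (u A @ U --> l)%classic.
  by move=> A; apply: ultra_limit => i; rewrite density_ge0 density_le1.
have uniq_lim (v : nat -> R) (l l' : R) :
    (v @ U --> l)%classic -> (v @ U --> l')%classic -> l = l'.
  by move=> h h'; apply: norm_cvg_unique h h'.
have le_lim (v w : nat -> R) (l l' : R) : (v @ U --> l)%classic ->
    (w @ U --> l')%classic -> (forall i, v i <= w i) -> l <= l'.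
  by move=> h h' vw; apply: ler_cvg_to h h' _; apply: filterE.
have muT : mu setT = 1.
  apply: uniq_lim (hmu _) _; rewrite (_ : u setT = cst 1); first exact: cvg_cst.
  by apply/funext => i; apply: densityT; exact: (hFi i).1.
have muU A B : (A `&` B = set0)%classic -> mu (A `|` B)%classic = mu A + mu B.
  move=> AB; apply: uniq_lim (hmu _) _.
  rewrite (_ : u (A `|` B)%classic = u A \+ u B); first exact: cvgD (hmu A) (hmu B).
  by apply/funext => i; exact: densityU.
have muC A : mu (~` A)%classic = 1 - mu A.
  by rewrite -muT -(setUv A) muU ?setICr // addrC addKr.
pose tr g A := [set (g * a)%g | a in A]%classic.
have trE g A h : tr g A h <-> A (g^-1 * h)%g.
  split=> [[a ha <-]|hh]; first by rewrite mulKg.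
  by exists (g^-1 * h)%g => //; rewrite mulVKg.
have trC g A : tr g (~` A)%classic = (~` tr g A)%classic.
  by apply/seteqP; split=> h; rewrite /setC /= !trE.
have trM g h A : tr (g * h)%g A = tr g (tr h A).
  by apply/seteqP; split=> k; rewrite !trE invgM mulgA.
have tr1 A : tr 1%g A = A.
  by apply/seteqP; split=> k; rewrite trE invg1 mul1g.
have mu_le j A : mu (tr (x j) A) <= mu A.
  rewrite -[leRHS]addr0; apply: (le_lim (u (tr (x j) A)) (u A \+ harmonic)) => //.
    by apply: cvgD => // N hN; apply: UF; exact: cvg_harmonic.
  by move=> i; apply: density_translate; [exact: (hFi i).1|exact: (hFi i).2].
(* The converse inequality follows by passing to the complement. *)
have mu_x j A : mu (tr (x j) A) = mu A.
  apply/eqP; rewrite eq_le mu_le /=.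
  by have := mu_le j (~` A)%classic; rewrite trC !muC; lra.
exists mu; split=> //.
  move=> A; apply: (le_lim (cst 0) (u A)) => //; first exact: cvg_cst.
  by move=> i; exact: density_ge0.
move=> g; have [w <-] := gen g; elim: w => [|l w IH] A.
  by rewrite eval_nil -/(tr _ _) tr1.
rewrite eval_cons -/(tr _ _) trM; case: l => j [] /=.
  by rewrite mu_x; exact: IH.
by rewrite -(mu_x j) -trM mulgV tr1; exact: IH.
Qed.

End FolnerAmenable.

(** * The normalized cyclomatic quotient *)

Theorem proposition2p3 (R : realType) (G : groupType) (n : nat) (x : 'I_n -> G)
    (rels : set (word 'I_n)) (hpres : presents x rels) :
  [/\ ((1 - n%:R)%:E <= normalized_cyclomatic_quotient R x <= 1)%E,
      amenable R G ->
        normalized_cyclomatic_quotient R x = (inv_card R G)%:E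
    & ~ amenable R G ->
        [/\ ((1 - n%:R)%:E <= normalized_cyclomatic_quotient R x)%E,
            (normalized_cyclomatic_quotient R x < 0)%E
          & normalized_cyclomatic_quotient R x = (1 - n%:R)%:E <->
            free_of_rank G n /\ (2 <= n)%N]].
Proof.
have gen := hpres.1.
have ge0 := cyclomatic_quotient_ge0 R gen.
have le := cyclomatic_quotient_le R x.
have [q hq] : exists q : R, cyclomatic_quotient R x = q%:E.
  exists (fine (cyclomatic_quotient R x)); rewrite fineK // fin_numElt.
  rewrite (lt_le_trans _ ge0) ?ltNyr //=.
  by rewrite (le_lt_trans le) // ltry.
have normE : normalized_cyclomatic_quotient R x = (1 - n%:R + q)%:E.
  by rewrite /normalized_cyclomatic_quotient hq -EFinD.
have inv1 := inv_card_le1 R G.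
rewrite hq !lee_fin in ge0 le.
have lb : ((1 - n%:R)%:E <= normalized_cyclomatic_quotient R x)%E.
  by rewrite normE lee_fin; lra.
split; first by rewrite lb normE lee_fin; lra.
- move=> /(amenable_folner x) /(folner_cyclomatic_quotient gen).
  by rewrite normE hq => -[->]; congr EFin; lra.
move=> nam.
have lt0 : (normalized_cyclomatic_quotient R x < 0)%E.
  have /not_folner_lt : ~ folner R x by move=> /(folner_amenable gen).
  by rewrite normE hq !lte_fin; lra.
split=> //; split.
- rewrite normE => -[hn].
  have q0 : q = 0 by lra.
  split.
    exists x; split=> // w; split=> [hw|hw]; last first.
      by rewrite (eval_free_eq x hw) eval_nil.
    suff hx : free_family x by exact: hx.
    by apply: contrapT => /(nonfree_cyclomatic_quotient R gen); rewrite hq q0 ltxx.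
  move: lt0; rewrite normE lte_fin q0; case: (n) => [|[|m]] //.
    by rewrite subr0 addr0 ltNge ler01.
  by rewrite subrr addr0 ltxx.
- move=> [hfree _]; rewrite normE; congr EFin.
  have := free_cyclomatic_quotient R gen (free_of_rank_free_family gen hfree).
  by rewrite hq => -[->]; rewrite addr0.
Qed.
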